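(* Let $s\in(0,1)$ and let $p:\mathbb{R}^N\times\mathbb{R}^N\to\mathbb{R}$ and $q:\mathbb{R}^N\to\mathbb{R}$ satisfy conditions $(\mathcal P_2)$ and $(\mathcal Q_2)$ stated in the context. Let $\{u_n\}$ be a bounded sequence in $W^{s,p(\cdot,\cdot)}(\mathbb{R}^N)$ such that $u_n\rightharpoonup u$ weakly in $W^{s,p(\cdot,\cdot)}(\mathbb{R}^N)$, $$|u_n|^{\overline p}+\int_{\mathbb{R}^N}\frac{|u_n(x)-u_n(y)|^{p(x,y)}}{|x-y|^{N+sp(x,y)}}\,dy\overset{*}{\rightharpoonup}\mu\quad\text{and}\quad |u_n|^{q(x)}\overset{*}{\rightharpoonup}\nu\quad\text{in }\mathcal M(\mathbb{R}^N).$$ Set $$\nu_\infty:=\lim_{R\to\infty}\limsup_{n\to\infty}\int_{B_R^c}|u_n|^{q(x)}\,dx,$$ $$\mu_\infty:=\lim_{R\to\infty}\limsup_{n\to\infty}\int_{B_R^c}\left[|u_n|^{\overline p}+\int_{\mathbb{R}^N}\frac{|u_n(x)-u_n(y)|^{p(x,y)}}{|x-y|^{N+sp(x,y)}}\,dy\right]dx.$$ Then $$\limsup_{n\to\infty}\int_{\mathbb{R}^N}|u_n|^{q(x)}\,dx=\nu(\mathbb{R}^N)+\nu_\infty,$$ $$\limsup_{n\to\infty}\int_{\mathbb{R}^N}\left[|u_n|^{\overline p}+\int_{\mathbb{R}^N}\frac{|u_n(x)-u_n(y)|^{p(x,y)}}{|x-y|^{N+sp(x,y)}}\,dy\right]dx=\mu(\mathbb{R}^N)+\mu_\infty.$$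 Assume in addition that $\lim_{|x|,|y|\to\infty}p(x,y)=\overline p$ and that $\lim_{|x|\to\infty}q(x)=q_\infty$ for some $q_\infty\in(1,\infty)$. Then $$S_q\,\nu_\infty^{1/q_\infty}\le\mu_\infty^{1/\overline p}.$$
   Context: $B_R$ is the ball of radius $R$ centered at $0$ and $B_R^c=\mathbb{R}^N\setminus B_R$. $(\mathcal P_2)$: $p:\mathbb{R}^N\times\mathbb{R}^N\to\mathbb{R}$ is uniformly continuous and symmetric with $1<p^-:=\inf p\le\sup p=:\overline p<N/s$; there exists $\varepsilon_0\in(0,\tfrac12)$ such that $p(x,y)=\overline p$ whenever $|x-y|<\varepsilon_0$, and $\sup_{y\in\mathbb{R}^N}p(x,y)=\overline p$ for all $x\in\mathbb{R}^N$; and the set $\{x\in\mathbb{R}^N:p_*(x)\neq\overline p\}$ has finite Lebesgue measure, where $p_*(x):=\inf_{y\in\mathbb{R}^N}p(x,y)$. $(\mathcal Q_2)$: $q:\mathbb{R}^N\to\mathbb{R}$ is uniformly continuous with $p_*(x)\le q(x)\le\overline p_s^*$ for all $x\in\mathbb{R}^N$, where $\overline p_s^*:=\frac{N\overline p}{N-s\overline p}$, and $\mathcal C:=\{x\in\mathbb{R}^N:q(x)=\overline p_s^*\}\ne\emptyset$. Note $p(x,x)=\overline p$ for all $x$. $W^{s,p(\cdot,\cdot)}(\mathbb{R}^N)$ is the Banach space of $u\in L^{\overline p}(\mathbb{R}^N)$ with $\int_{\mathbb{R}^N}\int_{\mathbb{R}^N}\frac{|u(x)-u(y)|^{p(x,y)}}{|x-y|^{N+sp(x,y)}}dx\,dy<\infty$,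 with norm $\|u\|_{s,p}:=\inf\{\lambda>0:M(u/\lambda)<1\}$, $M(u):=\int_{\mathbb{R}^N}|u|^{\overline p}dx+\int_{\mathbb{R}^N}\int_{\mathbb{R}^N}\frac{|u(x)-u(y)|^{p(x,y)}}{|x-y|^{N+sp(x,y)}}dx\,dy$. $L^{q(\cdot)}(\mathbb{R}^N)$ is the variable exponent Lebesgue space (measurable $u$ with $\int|u|^{q(x)}dx<\infty$) with Luxemburg norm $\inf\{\lambda>0:\int_{\mathbb{R}^N}|u(x)/\lambda|^{q(x)}dx\le1\}$. One has $W^{s,p(\cdot,\cdot)}(\mathbb{R}^N)\hookrightarrow L^{q(\cdot)}(\mathbb{R}^N)$ continuously, so that $$S_q:=\inf_{u\in W^{s,p(\cdot,\cdot)}(\mathbb{R}^N)\setminus\{0\}}\frac{\|u\|_{s,p}}{\|u\|_{L^{q(\cdot)}(\mathbb{R}^N)}}>0.$$ $\mathcal M(\mathbb{R}^N)$ is the space of signed finite Radon measures on $\mathbb{R}^N$ with the total variation norm, identified with the dual of $C_0(\mathbb{R}^N)$ (the closure of the compactly supported continuous functions in the supremum norm); $\overset{*}{\rightharpoonup}$ is weak-$*$ convergence in this dual. Integrable functions are identified with the measures having them as Lebesgue densities. *)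

(* Defs.v *)
From HB Require Import structures.
From mathcomp Require Import all_boot all_order all_algebra.
From mathcomp Require Import all_classical all_reals all_analysis.

Set Implicit Arguments.
Unset Strict Implicit.
Unset Printing Implicit Defensive.

Import Order.TTheory GRing.Theory Num.Theory.
Import numFieldNormedType.Exports.

Local Open Scope classical_set_scope.
Local Open Scope ring_scope.

(* 'rV[R]_n carries the product sigma-algebra, i.e. the one generated by the
   coordinates; over R it is the Borel sigma-algebra of the usual topology. *)
Definition measure_row_display : measure_display -> measure_display.
Proof. exact. Qed.

Section measurable_row.
Context {d} {T : measurableType d}.
Variable n : nat.

Let coord : 'I_n -> 'rV[T]_n -> T := fun i x => x ord0 i.

Let row_set0 : g_sigma_preimage coord set0.
Proof. exact: sigma_algebra0. Qed.

Let row_setC A : g_sigma_preimage coord A -> g_sigma_preimage coord (~` A).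
Proof. exact: sigma_algebraC. Qed.

Let row_bigcup (F : _^nat) : (forall i, g_sigma_preimage coord (F i)) ->
  g_sigma_preimage coord (\bigcup_i (F i)).
Proof. exact: sigma_algebra_bigcup. Qed.

HB.instance Definition _ := @isMeasurable.Build (measure_row_display d)
  'rV[T]_n (g_sigma_preimage coord) row_set0 row_setC row_bigcup.

End measurable_row.

Lemma measurable_coord d (T : measurableType d) n (i : 'I_n) :
  measurable_fun [set: 'rV[T]_n] (fun x : 'rV[T]_n => x ord0 i).
Proof.
move=> _ Y mY; rewrite setTI; apply: sub_sigma_algebra => /=.
rewrite -bigcup_seq/=; exists i => /=; first by rewrite mem_index_enum.
by exists Y => //; rewrite setTI.
Qed.

Lemma measurable_fun_coordP d1 d2 (T1 : measurableType d1)
    (T2 : measurableType d2) n (f : T1 -> 'rV[T2]_n) :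
  (forall i, measurable_fun [set: T1] (fun x => f x ord0 i)) ->
  measurable_fun [set: T1] f.
Proof.
move=> mf.
suff : g_sigma_preimage (fun i => (fun y : 'rV[T2]_n => y ord0 i) \o f) `<=`
       measurable.
  rewrite g_sigma_preimage_comp => prefS.
  by move=> _ A mA; apply: prefS; exists A.
apply: smallest_sub; first exact: sigma_algebra_measurable.
case: n => [|n] in f mf *; first by rewrite big_ord0.
rewrite -bigcup_mkord_ord; apply: bigcup_sub => i Ii.
by move=> A [B mB <-]; exact: mf.
Qed.

Section lebesgue_row_step.
Context (R : realType) (n : nat).
Implicit Types (z : measurableTypeR R * 'rV[R]_n) (v : 'rV[R]_n.+1).

Definition row_cons z : 'rV[R]_n.+1 :=
  \row_i if unlift ord0 i is Some j then z.2 ord0 j else z.1.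

Definition row_uncons v : measurableTypeR R * 'rV[R]_n :=
  (v ord0 ord0, \row_j v ord0 (lift ord0 j)).

Lemma row_consK : cancel row_cons row_uncons.
Proof.
move=> [x v]; rewrite /row_uncons /row_cons !mxE unlift_none /=.
by congr pair; apply/rowP => j; rewrite !mxE liftK.
Qed.

Lemma measurable_row_cons : measurable_fun setT row_cons.
Proof.
apply: measurable_fun_coordP => i; case: (unliftP ord0 i) => [j ->|->].
- under eq_fun do rewrite mxE liftK.
  exact: measurableT_comp (measurable_coord j) measurable_snd.
- under eq_fun do rewrite mxE unlift_none.
  exact: measurable_fst.
Qed.

Lemma measurable_row_uncons : measurable_fun setT row_uncons.
Proof.
apply: measurable_fun_pair; first exact: measurable_coord.
apply: measurable_fun_coordP => i; under eq_fun do rewrite mxE.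
exact: measurable_coord.
Qed.

Variable m : {sigma_finite_measure set 'rV[R]_n -> \bar R}.

Definition lebesgue_row_step : set 'rV[R]_n.+1 -> \bar R :=
  pushforward (@lebesgue_measure R \x m)%E row_cons.

Let step0 : lebesgue_row_step set0 = 0%E.
Proof. by rewrite /lebesgue_row_step /pushforward preimage_set0 measure0. Qed.

Let step_ge0 A : (0 <= lebesgue_row_step A)%E.
Proof. by rewrite /lebesgue_row_step /pushforward; exact: measure_ge0. Qed.

Let mpre (A : set 'rV[R]_n.+1) :
  measurable A -> measurable (row_cons @^-1` A).
Proof. by move=> mA; rewrite -[X in measurable X]setTI; exact: measurable_row_cons. Qed.

Let step_sigma_additive : semi_sigma_additive lebesgue_row_step.
Proof.
move=> F mF tF mUF; rewrite /lebesgue_row_step /pushforward preimage_bigcup.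
apply: measure_semi_sigma_additive.
- by move=> k; exact: mpre.
- apply/trivIsetP => i j _ _ ij; rewrite -preimage_setI.
  by move/trivIsetP : tF => /(_ _ _ _ _ ij) ->//; rewrite preimage_set0.
- by rewrite -preimage_bigcup; exact: mpre.
Qed.

HB.instance Definition _ := isMeasure.Build _ _ _ lebesgue_row_step
  step0 step_ge0 step_sigma_additive.

Let step_sigma_finite : sigma_finite setT lebesgue_row_step.
Proof.
have /sigma_finiteP[F [TF ndF Foo]] := sigma_finiteT (@lebesgue_measure R).
have /sigma_finiteP[G [TG ndG Goo]] := sigma_finiteT m.
exists (fun k => row_uncons @^-1` (F k `*` G k)) => [|k].
- rewrite -preimage_bigcup -[LHS](preimage_setT row_uncons); congr preimage.
  rewrite -setXTT TF TG predeqE => -[x y]; split.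
  + move=> [/= [i _ Fix] [k _ Gky]]; exists (maxn i k) => //; split.
      by move: x Fix; exact/subsetPset/ndF/leq_maxl.
    by move: y Gky; exact/subsetPset/ndG/leq_maxr.
  + by move=> [i _ []/= ? ?]; split; exists i.
- have [? ?] := Foo k; have [? ?] := Goo k; split.
    rewrite -[X in measurable X]setTI; apply: measurable_row_uncons => //.
    exact: measurableX.
  rewrite /lebesgue_row_step /pushforward -comp_preimage.
  rewrite (_ : row_uncons \o row_cons = id) ?preimage_id; last first.
    exact/funext/row_consK.
  by rewrite product_measure1E// lte_mul_pinfty// ge0_fin_numE.
Qed.

HB.instance Definition _ := Measure_isSigmaFinite.Build _ _ _ lebesgue_row_step
  step_sigma_finite.

End lebesgue_row_step.

Fixpoint lebesgue_rV (R : realType) (n : nat) :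
    {sigma_finite_measure set 'rV[R]_n -> \bar R} :=
  match n with
  | 0%N => [the {sigma_finite_measure set _ -> \bar R} of dirac (0 : 'rV[R]_0)]
  | k.+1 => [the {sigma_finite_measure set _ -> \bar R} of
              lebesgue_row_step (lebesgue_rV R k)]
  end.

Lemma lebesgue_rV_box (R : realType) n (A : 'I_n -> set R) :
  (forall i, measurable (A i)) ->
  lebesgue_rV R n [set x : 'rV[R]_n | forall i, A i (x ord0 i)] =
  (\prod_(i < n) lebesgue_measure (A i : set (measurableTypeR R)))%E.
Proof.
elim: n A => [|n IHn] A mA /=.
  by rewrite big_ord0 diracE mem_set//= => -[].
pose B : set 'rV[R]_n := [set x | forall i, A (lift ord0 i) (x ord0 i)].
rewrite big_ord_recl -(IHn _ (fun i => mA (lift ord0 i))) -/B.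
have mB : measurable B.
  rewrite (_ : B = \bigcap_(i in [set: 'I_n])
      ((fun x : 'rV[R]_n => x ord0 i) @^-1` A (lift ord0 i))); last first.
    by apply/seteqP; split => x /= h i; [move=> _|]; exact: h.
  apply: fin_bigcap_measurable => // i _.
  by rewrite -[X in measurable X]setTI; exact: measurable_coord.
transitivity ((@lebesgue_measure R \x lebesgue_rV R n)%E (A ord0 `*` B)).
  rewrite /lebesgue_row_step /pushforward; congr product_measure1.
  apply/seteqP; split => -[x v] /=.
  - move=> h; split; first by have := h ord0; rewrite mxE unlift_none.
    by move=> i; have := h (lift ord0 i); rewrite mxE liftK.
  - move=> [Ax Av] i; rewrite mxE /=.
    by case: (unliftP ord0 i) => [j ->|->].
exact: (@product_measure1E _ _ (measurableTypeR R) _ _ _ _ _ _ (mA ord0) mB).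
Qed.

Section exponents.
Context (R : realType) (N : nat).
Local Notation E := 'rV[R]_N.
Implicit Types (s : R) (p : E -> E -> R) (q : E -> R).

(* The library norm `|x| on 'rV[R]_N is the sup norm; it induces the same
   topology and uniformity as the Euclidean norm. *)
Definition enorm (x : E) : R := Num.sqrt (\sum_(i < N) x ord0 i ^+ 2).

Definition eball (r : R) : set E := [set x | enorm x < r].

Definition einfty : set_system E :=
  filter_from [set: R] (fun r => [set x | r < enorm x]).

Definition pinf p : R := inf [set p z.1 z.2 | z in [set: E * E]].
Definition pbar p : R := sup [set p z.1 z.2 | z in [set: E * E]].
Definition plow p (x : E) : R := inf (range (p x)).
Definition sobolev_exp s p : R := N%:R * pbar p / (N%:R - s * pbar p).

(* inf and sup are total on sets of reals, so boundedness is made explicit. *)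
Definition condP2 s p : Prop :=
  [/\ unif_continuous (fun z : E * E => p z.1 z.2),
      (forall x y, p x y = p y x),
      [/\ has_lbound [set p z.1 z.2 | z in [set: E * E]],
          has_ubound [set p z.1 z.2 | z in [set: E * E]],
          1 < pinf p & pbar p < N%:R / s],
      (exists2 e0 : R, 0 < e0 < 2^-1 &
         forall x y, enorm (x - y) < e0 -> p x y = pbar p) /\
      (forall x, sup (range (p x)) = pbar p) &
      (lebesgue_rV R N [set x | plow p x <> pbar p] < +oo)%E].

Definition condQ2 s p q : Prop :=
  [/\ unif_continuous q,
      (forall x, plow p x <= q x <= sobolev_exp s p) &
      [set x | q x = sobolev_exp s p] !=set0].

End exponents.

Section spaces.
Context (R : realType) (N : nat).
Local Notation E := 'rV[R]_N.
Local Notation leb := (lebesgue_rV R N).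
Implicit Types (s : R) (p : E -> E -> R) (q u : E -> R).

(* The diagonal is harmless: both powers vanish there, and 0 / 0 = 0. *)
Definition gagliardo s p u (x : E) : \bar R :=
  (\int[leb]_y (`|u x - u y| `^ p x y /
                enorm (x - y) `^ (N%:R + s * p x y))%:E)%E.

Definition energy_density s p u (x : E) : \bar R :=
  ((`|u x| `^ pbar p)%:E + gagliardo s p u x)%E.

Definition q_density q u (x : E) : \bar R := (`|u x| `^ q x)%:E.

Definition W_modular s p u : \bar R :=
  (\int[leb]_x (`|u x| `^ pbar p)%:E + \int[leb]_x gagliardo s p u x)%E.

Definition inW s p u : Prop :=
  [/\ measurable_fun [set: E] u,
      (\int[leb]_x (`|u x| `^ pbar p)%:E < +oo)%E &
      (\int[leb]_x gagliardo s p u x < +oo)%E].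

Definition W_norm s p u : R :=
  inf [set l : R | 0 < l /\ (W_modular s p (fun x => u x / l)%R < 1)%E].

Definition Lq_norm q u : R :=
  inf [set l : R | 0 < l /\ (\int[leb]_x (`|u x / l| `^ q x)%:E <= 1)%E].

Definition S_q s p q : R :=
  inf [set W_norm s p u / Lq_norm q u |
       u in [set u | inW s p u /\ ~ {ae leb, forall x, u x = 0}]].

(* W is made of functions, not of classes; a bounded linear functional takes
   the same value on functions that agree almost everywhere, because the norm
   of their difference is zero. *)
Definition W_dual s p (L : (E -> R) -> R) : Prop :=
  [/\ (forall u v, inW s p u -> inW s p v ->
         L (fun x => u x + v x) = L u + L v),
      (forall (a : R) u, inW s p u -> L (fun x => a * u x) = a * L u) &
      exists C : R, forall u, inW s p u -> `|L u| <= C * W_norm s p u].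

Definition W_bounded s p (u_ : (E -> R)^nat) : Prop :=
  (forall n, inW s p (u_ n)) /\
  exists C : R, forall n, W_norm s p (u_ n) <= C.

Definition W_weak_cvg s p (u_ : (E -> R)^nat) u : Prop :=
  inW s p u /\
  forall L, W_dual s p L -> L (u_ n) @[n --> \oo] --> L u.

End spaces.

Section measures.
Context (R : realType) (N : nat).
Local Notation E := 'rV[R]_N.
Local Notation leb := (lebesgue_rV R N).

Definition C_c (f : E -> R) : Prop :=
  continuous f /\ compact (closure [set x | f x != 0]).

Definition C_0 (f : E -> R) : Prop :=
  forall e : R, 0 < e ->
    exists2 g, C_c g & forall x, `|f x - g x| <= e.

(* Charges of the library are finite signed measures; every finite signed
   Borel measure on R^N is Radon. *)
Definition charge_integral (mu : {charge set E -> \bar R}) (f : E -> R) :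
    \bar R :=
  let: exist P exN := cid (Hahn_decomposition mu) in
  let: exist Q muPQ := cid exN in
  (\int[jordan_pos muPQ]_x (f x)%:E - \int[jordan_neg muPQ]_x (f x)%:E)%E.

Definition weak_star_cvg (g_ : (E -> \bar R)^nat)
    (mu : {charge set E -> \bar R}) : Prop :=
  (forall n, leb.-integrable [set: E] (g_ n)) /\
  forall f, C_0 f ->
    (\int[leb]_x ((f x)%:E * g_ n x))%E @[n --> \oo] --> charge_integral mu f.

(* The limit in r exists since the expression is nonincreasing in r when the
   g_ n are nonnegative. *)
Definition mass_at_infinity (g_ : (E -> \bar R)^nat) : \bar R :=
  lim (limn_esup (fun n => (\int[leb]_(x in ~` @eball R N r) g_ n x)%E)
         @[r --> +oo]).

End measures.

(* Main.v *)
(* Test functions supported outside a large ball carry the mass at infinity.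
   Let [phi_r] be a Lipschitz cutoff vanishing on the ball of radius [r] and equal
   to [1] far away.  Since [1 - phi_r] is a test function for the weak-* convergence,
   splitting [1 = (1 - phi_r) + phi_r] in the integrals of the densities and letting
   [r] grow gives the first two equalities.

   For the inequality, apply the definition of [S_q] to [phi_r u_n].  In its modular
   at scale [lam], write
   [phi_r(x) u(x) - phi_r(y) u(y) =
      phi_r(x) (u(x) - u(y)) + u(y) (phi_r(x) - phi_r(y))]
   for [|x - y| < rho], and bound the two values separately for [|x - y| >= rho].
   The first term is controlled by the tail of the energy; there
   [lam ^ - p(x, y)] is close to [lam ^ - pbar], because both points are far from the
   origin.  All the other terms are at most
   [C (U(x) + U(y)) Psi(x - y)] with [U = |u|^pbar + 1_{p_* <> pbar}], a bounded
   family in [L^1], and [Psi] of arbitrarily small integral when [rho], then [r], are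
   large; no compactness of [(u_n)] is involved.  Hence the norm of [phi_r u_n] is
   eventually below any [lam > mu_oo ^ (1 / pbar)]; the Luxemburg norm of
   [phi_r u_n] is then at most [lam / S_q], and the convergence of [q] at infinity
   turns this into a bound on the tail of [|u_n|^q]. *)
Require Import Defs.
From mathcomp Require Import all_boot all_order all_algebra.
From mathcomp Require Import all_classical all_reals all_analysis.
From mathcomp Require Import measurable_realfun.
From mathcomp Require Import lra ring.

Set Implicit Arguments.
Unset Strict Implicit.
Unset Printing Implicit Defensive.

Import Order.TTheory GRing.Theory Num.Theory.
Import numFieldNormedType.Exports.

Local Open Scope classical_set_scope.
Local Open Scope ring_scope.

(** * Borel measurability of continuous functions *)

(** With countably many centers this is a countable union of balls and empty sets. It brings open
    sets into the sigma-algebras at hand, which are generated by coordinates. *)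
Lemma open_bigcup_ball (R : realType) (T : pseudoMetricType R) (I : Type)
    (c : I -> T) (U : set T) :
  (forall x e, 0 < e -> exists i, ball x e (c i)) -> open U ->
  U = \bigcup_(ik : I * nat)
        [set x | ball (c ik.1) ik.2.+1%:R^-1 `<=` U /\
                 ball (c ik.1) ik.2.+1%:R^-1 x].
Proof.
move=> dense oU; apply/seteqP; split=> [x Ux|x [_ _ [] /[apply]//]].
have /nbhs_ballP[e /= e0 xeU] : nbhs x U by exact: open_nbhs_nbhs.
(* Half the radius, since a ball of radius [1 / (k + 1)] containing [x] must stay inside
   [ball x e]. *)
have [k ke] : exists k : nat, k.+1%:R^-1 < e / 2 :> R.
  have e20 : 0 < e / 2 by rewrite divr_gt0.
  have [k _ /(_ _ (leqnn k))] := near_infty_natSinv_lt (PosNum e20).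
  by move=> h; exists k.
have k0 : 0 < k.+1%:R^-1 :> R by rewrite invr_gt0.
have [i xi] := dense x _ k0.
exists (i, k) => //=; split; last exact: ball_sym.
move=> y /(ball_triangle xi) xy; apply: xeU.
by apply: le_ball xy; rewrite ltW// [ltRHS]splitr ltrD.
Qed.

Section measurable_open.
Context (R : realType) (N : nat).
Local Notation E := 'rV[R]_N.

Lemma rV_ratr_dense (x : E) (e : R) : 0 < e ->
  exists v : 'rV[rat]_N, ball x e (map_mx ratr v).
Proof.
move=> e0.
have h i : exists r : rat, `|x ord0 i - ratr r| < e.
  have : x ord0 i - e < x ord0 i + e by rewrite ltrD2l gtrN.
  move=> /rat_in_itvoo[r]; rewrite in_itv/= => /andP[r1 r2]; exists r.
  by rewrite ltr_distlC r1.
exists (\row_i projT1 (cid (h i))); split=> // i j.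
by rewrite !mxE (ord1 i); exact: projT2 (cid (h j)).
Qed.

Lemma measurable_rV_ball (x : E) (e : R) : measurable (ball x e).
Proof.
(* A ball of nonpositive radius is empty by definition, whereas for [N = 0] the intersection of
   coordinate conditions below is the whole space. *)
have [e0|e0] := ltP 0 e; last first.
  rewrite (_ : ball x e = set0)//.
  by apply/seteqP; split=> // y [/lt_le_trans/(_ e0)]; rewrite ltxx.
rewrite (_ : ball x e = \bigcap_(i in [set: 'I_N])
    ((fun y : E => y ord0 i) @^-1` ball (x ord0 i) e)); last first.
  apply/seteqP; split => y /=.
    by move=> [_ h] i _; exact: h.
  by move=> h; split=> // i j; rewrite (ord1 i); exact: h.
apply: fin_bigcap_measurable => // i _.
rewrite -[X in measurable X]setTI; apply: measurable_coord => //.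
by apply: open_measurable; exact: ball_open.
Qed.

Lemma open_measurable_rV (U : set E) : open U -> measurable U.
Proof.
move=> oU; rewrite (@open_bigcup_ball _ _ _ _ _ rV_ratr_dense oU).
apply: countable_bigcupT_measurable => [|[v k]/=]; first exact: countableP.
have [vU|vU] := pselect (ball (map_mx ratr v : E) k.+1%:R^-1 `<=` U).
  rewrite (_ : [set x | _] = ball (map_mx ratr v : E) k.+1%:R^-1).
    exact: measurable_rV_ball.
  by apply/seteqP; split=> [x []|x].
by rewrite (_ : [set x | _] = set0)//; apply/seteqP; split=> x// [].
Qed.

(** Tonelli's theorem needs joint measurability for the product sigma-algebra; centers with rational
    coordinates in both factors are still countable. *)
Lemma open_measurable_rV2 (U : set (E * E)) : open U -> measurable U.
Proof.
move=> oU.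
pose c (v : 'rV[rat]_N * 'rV[rat]_N) : E * E :=
  (map_mx ratr v.1, map_mx ratr v.2).
have cP x e : 0 < e -> exists i, ball x e (c i).
  move=> e0; have [v1 h1] := rV_ratr_dense x.1 e0.
  by have [v2 h2] := rV_ratr_dense x.2 e0; exists (v1, v2).
rewrite (@open_bigcup_ball _ _ _ _ _ cP oU).
apply: countable_bigcupT_measurable => [|[v k]/=]; first exact: countableP.
have [vU|vU] := pselect (ball (c v) k.+1%:R^-1 `<=` U).
  rewrite (_ : [set x | _] = ball (c v).1 k.+1%:R^-1 `*` ball (c v).2 k.+1%:R^-1).
    by apply: measurableX; exact: measurable_rV_ball.
  by apply/seteqP; split=> [x []|x].
by rewrite (_ : [set x | _] = set0)//; apply/seteqP; split=> x// [].
Qed.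

Lemma continuous_measurable_rV (f : E -> R) :
  continuous f -> measurable_fun [set: E] f.
Proof.
move=> cf; move=> mT; apply: (measurability _ (RGenOpens.measurableE R)) => //.
move=> _ [_ [a [b ->]] <-].
rewrite setTI; apply: open_measurable_rV.
by apply: open_comp => [x _|]; [exact: cf|exact: interval_open].
Qed.

Lemma continuous_measurable_rV2 (f : E * E -> R) :
  continuous f -> measurable_fun [set: E * E] f.
Proof.
move=> cf; move=> mT; apply: (measurability _ (RGenOpens.measurableE R)) => //.
move=> _ [_ [a [b ->]] <-].
rewrite setTI; apply: open_measurable_rV2.
by apply: open_comp => [x _|]; [exact: cf|exact: interval_open].
Qed.

End measurable_open.

Lemma unif_continuous_continuous (R : realType) (U V : pseudoMetricType R)
  (f : U -> V) : unif_continuous f -> continuous f.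
Proof.
move=> /unif_continuousP uf x; apply/cvg_ballP => e e0.
have [d d0 fd] := uf e e0.
by near=> y; apply: (fd (x, y)); near: y; exact: nbhsx_ballx.
Unshelve. all: by end_near. Qed.

(** * Upper limits and cutoff functions *)

Section limn_esup_extra.
Context (R : realType).
Local Open Scope ereal_scope.
Implicit Types (u v : (\bar R)^nat).

(** The upper limit is an infimum of suprema over the sets of the filter; one of these suprema is
    already below [m]. *)
Lemma limn_esup_lt u m : limn_esup u < m -> \forall n \near \oo, u n < m.
Proof.
move=> /ereal_inf_lt[_ [A Aoo <-]] um.
apply: filterS Aoo => n An; apply: le_lt_trans um.
by apply: ereal_sup_ubound; exists n.
Qed.

Lemma le_limn_esup u v : (\forall n \near \oo, u n <= v n) ->
  limn_esup u <= limn_esup v.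
Proof.
move=> uv; apply: le_ereal_inf_tmp => _ [A Aoo <-].
apply: (@le_trans _ _ (ereal_sup (u @` (A `&` [set n | u n <= v n])))).
  by apply: ereal_inf_lbound; exists (A `&` [set n | u n <= v n]) => //; exact: filterI.
apply: ge_ereal_sup => _ [n [An un] <-].
by apply: (le_trans un); apply: ereal_sup_ubound; exists n.
Qed.

Lemma limn_esup_cst (m : \bar R) : limn_esup (fun=> m) = m.
Proof.
have h : (fun=> m) @ \oo --> m by exact: cvg_cst.
by have [_ ->] := cvg_limn_einf_sup h.
Qed.

Lemma limn_esup_le u m : (\forall n \near \oo, u n <= m) -> limn_esup u <= m.
Proof. by move=> um; rewrite -[leRHS]limn_esup_cst; exact: le_limn_esup. Qed.

Lemma limn_esup_shift u (l : R) :
  limn_esup (fun n => l%:E + u n) = l%:E + limn_esup u.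
Proof.
have oppD (a : \bar R) : - (- l%:E - a) = l%:E + a.
  by rewrite addeC fin_num_oppeD// !oppeK addeC.
have := @limn_einf_shift R (-%E \o u) (- l%:E) isT.
rewrite limn_einfN => /(congr1 (@oppe R)); rewrite oppD => <-.
rewrite -limn_esupN; congr limn_esup; apply/funext => n /=.
by rewrite oppD.
Qed.

(** Up to [e], [u n] may be replaced by its finite limit, and a finite constant leaves the upper
    limit even when that of [v] is infinite. *)
Lemma cvg_limn_esupD u v (l : R) : u @ \oo --> l%:E ->
  limn_esup (fun n => u n + v n) = l%:E + limn_esup v.
Proof.
move=> ul.
have near_u e : (0 < e)%R -> \forall n \near \oo, (l - e)%:E <= u n <= (l + e)%:E.
  move=> e0; have /fine_cvgP[fu /cvgrPdist_le/(_ e e0) ue] := ul.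
  near=> n; have un : u n \is a fin_num by near: n.
  have : (`|l - fine (u n)| <= e)%R by near: n.
  by rewrite -(fineK un) !lee_fin ler_distlC.
apply/eqP; rewrite eq_le; apply/andP; split.
  apply/lee_addgt0Pr => e e0; rewrite addeAC -EFinD -limn_esup_shift.
  apply: le_limn_esup; apply: filterS (near_u e e0) => n /andP[_ h].
  by rewrite leeD2r.
apply/lee_addgt0Pr => e e0.
rewrite -leeBlDr// addeAC -EFinB -limn_esup_shift.
apply: le_limn_esup; apply: filterS (near_u e e0) => n /andP[h _].
by rewrite leeD2r.
Unshelve. all: by end_near. Qed.

End limn_esup_extra.

(** * Comparison of the Euclidean norm with the sup norm *)

Section enorm.
Context (R : realType) (N : nat).
Local Notation E := 'rV[R]_N.
Implicit Types (x y : E).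

Lemma enorm_ge0 x : 0 <= enorm x.
Proof. exact: sqrtr_ge0. Qed.

Lemma enormB x y : enorm (x - y) = enorm (y - x).
Proof.
by congr Num.sqrt; apply: eq_bigr => i _; rewrite !mxE -sqrrN opprB.
Qed.

Lemma coord_le_norm x i : `|x ord0 i| <= `|x|.
Proof.
rewrite [leRHS]mx_normrE.
exact: (le_bigmax _ (fun ij : 'I_1 * 'I_N => `|x ij.1 ij.2|) (ord0, i)).
Qed.

Lemma coord_le_enorm x i : `|x ord0 i| <= enorm x.
Proof.
rewrite -sqrtr_sqr ler_wsqrtr// (bigD1 i)//= lerDl.
by apply: sumr_ge0 => j _; rewrite sqr_ge0.
Qed.

Lemma norm_le_enorm x : `|x| <= enorm x.
Proof.
rewrite [leLHS]mx_normrE; apply: bigmax_le; first exact: enorm_ge0.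
by move=> [i j] _ /=; rewrite (ord1 i) coord_le_enorm.
Qed.

(** The crude constant [N] in place of its square root suffices; it is the source of the factors [N]
    in the radii below. *)
Lemma enorm_le_norm x : enorm x <= N%:R * `|x|.
Proof.
have xN : 0 <= N%:R * `|x| by rewrite mulr_ge0.
rewrite -(ger0_norm xN) -sqrtr_sqr ler_wsqrtr//.
apply: (@le_trans _ _ (\sum_(i < N) `|x| ^+ 2)).
  apply: ler_sum => i _.
  by rewrite -[leLHS]real_normK ?num_real// lerXn2r ?nnegrE// coord_le_norm.
rewrite sumr_const card_ord -[leLHS]mulr_natl exprMn.
by rewrite ler_wpM2r ?sqr_ge0// -natrX ler_nat; case: (N) => // n; rewrite leq_pmulr.
Qed.

Lemma measurable_enorm : measurable_fun [set: E] (@enorm R N).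
Proof.
apply: (@measurableT_comp _ _ _ _ _ _ (@Num.sqrt R)).
  by apply: continuous_measurable_fun; exact: sqrt_continuous.
apply: measurable_sum => i; apply: measurable_funX; exact: measurable_coord.
Qed.

Lemma measurable_eball r : measurable (@eball R N r).
Proof.
rewrite (_ : eball r = (@enorm R N) @^-1` `]-oo, r[).
  by rewrite -[X in measurable X]setTI; exact: measurable_enorm.
by apply/seteqP; split=> x; rewrite /= in_itv.
Qed.

Lemma subset_eball r r' : r <= r' -> @eball R N r `<=` eball r'.
Proof. by move=> rr' x xr; exact: lt_le_trans rr'. Qed.

End enorm.

(** * Lipschitz cutoff functions *)

Section cutoff.
Context (R : realType) (N : nat).
Local Notation E := 'rV[R]_N.
Implicit Types (x y : E) (r : R).

(** Piecewise linear in the sup norm, rising from [0] to [1] between the radii [r] and [2 * r]. *)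
Definition cutoff r x : R := Num.min 1 (Num.max 0 (`|x| / r - 1)).

Lemma cutoff_ge0 r x : 0 <= cutoff r x.
Proof. by rewrite /cutoff le_min ler01 le_max lexx. Qed.

Lemma cutoff_le1 r x : cutoff r x <= 1.
Proof. by rewrite /cutoff ge_min lexx. Qed.

Lemma cutoff_eq0 r x : 0 < r -> `|x| <= r -> cutoff r x = 0.
Proof.
move=> r0 xr; rewrite /cutoff max_l ?min_r//.
by rewrite subr_le0 ler_pdivrMr// mul1r.
Qed.

Lemma cutoff_eq1 r x : 0 < r -> 2 * r <= `|x| -> cutoff r x = 1.
Proof.
move=> r0 xr; rewrite /cutoff min_l// le_max lerBrDr ler_pdivlMr//.
by rewrite -[1 + 1]/(2%:R) xr orbT.
Qed.

(** Clamping to the unit interval does not increase distances, so only the slope [1 / r] of the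
    inner function counts. *)
Lemma cutoff_lip r x y : 0 < r -> `|cutoff r x - cutoff r y| <= `|x - y| / r.
Proof.
move=> r0.
have clampP (a b : R) :
    `|Num.min 1 (Num.max 0 a) - Num.min 1 (Num.max 0 b)| <= `|a - b|.
  wlog ab : a b / a <= b.
    by move=> h; have [/h//|/ltW/h] := leP a b; rewrite distrC [leRHS]distrC.
  rewrite distrC [leRHS]distrC (ger0_norm (_ : 0 <= b - a)) ?subr_ge0//.
  rewrite ger0_norm; first by rewrite /Num.min /Num.max; do ![case: ifPn]; lra.
  by rewrite /Num.min /Num.max; do ![case: ifPn]; lra.
apply: le_trans (clampP _ _) _.
rewrite opprB addrA subrK -mulrBl normrM (gtr0_norm (_ : 0 < r^-1)) ?invr_gt0//.
by rewrite ler_pM2r ?invr_gt0// ler_dist_dist.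
Qed.

Lemma lipschitz_continuous (f : E -> R) (k : R) : 0 < k ->
  (forall x y, `|f x - f y| <= `|x - y| / k) -> continuous f.
Proof.
move=> k0 fk; apply: unif_continuous_continuous.
apply/unif_continuousP => e e0; exists (e * k) => [|[x y]/=]; first exact: mulr_gt0.
rewrite -!ball_normE => xy; apply: (le_lt_trans (fk _ _)).
by rewrite ltr_pdivrMr.
Qed.

Lemma cutoff_continuous r : 0 < r -> continuous (cutoff r).
Proof.
by move=> r0; apply: (lipschitz_continuous r0) => x y; exact: cutoff_lip.
Qed.

Lemma measurable_cutoff r : 0 < r -> measurable_fun [set: E] (cutoff r).
Proof. by move=> r0; apply: continuous_measurable_rV; exact: cutoff_continuous. Qed.

(** The support lies in the closed sup-norm ball of radius [2 * r], which is compact. *)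
Lemma C_c_cutoffC r : 0 < r -> C_c (fun x : E => 1 - cutoff r x).
Proof.
move=> r0; split.
  apply: (lipschitz_continuous r0) => x y.
  by rewrite opprB addrC addrA subrK distrC cutoff_lip.
have sub : closure [set x : E | 1 - cutoff r x != 0] `<=`
    [set x : E | `|x| <= 2 * r].
  have cB : closed [set x : E | `|x| <= 2 * r].
    apply: (@closed_comp _ _ (fun x : E => `|x|) [set y : R | y <= 2 * r]).
      by move=> x _; exact: norm_continuous.
    exact: closed_le.
  rewrite [X in _ `<=` X]((closure_id _).1 cB).
  apply: closure_subset => x /=; apply: contraNT; rewrite -ltNge => /ltW xr.
  by rewrite cutoff_eq1// subrr.
apply: bounded_closed_compact; last exact: closed_closure.
exists (2 * r); split; first exact: num_real.
by move=> M rM x /sub /= /le_trans; apply; exact: ltW.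
Qed.

Lemma cutoff_neq0 r x : 0 < r -> cutoff r x != 0 -> ~ eball r x.
Proof.
move=> r0 + xr; apply/negP; rewrite negbK; apply/eqP; apply: cutoff_eq0 => //.
by apply: le_trans (norm_le_enorm x) _; exact: ltW.
Qed.

Lemma cutoff_eq1_eball r x : 0 < r -> (0 < N)%N ->
  ~ eball (2 * N%:R * r) x -> cutoff r x = 1.
Proof.
move=> r0 N0 /negP; rewrite -leNgt => xr; apply: cutoff_eq1 => //.
rewrite -(@ler_pM2l _ N%:R) ?ltr0n//.
by apply: le_trans (enorm_le_norm x); rewrite mulrCA mulrA.
Qed.

End cutoff.

(** * Mass at infinity *)

Section concentration_at_infinity.
Context (R : realType) (N : nat).
Local Notation E := 'rV[R]_N.
Local Notation leb := (lebesgue_rV R N).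
Local Open Scope ereal_scope.

(** Dominated convergence: each point is eventually in the region where the cutoff vanishes, and the
    constant [1] is integrable for a finite measure. *)
Lemma cvg_integral_cutoffC (m : {finite_measure set E -> \bar R}) :
  \int[m]_x (1 - cutoff k.+1%:R x)%:E @[k --> \oo] --> m setT.
Proof.
have [] := @dominated_convergence _ _ R m setT measurableT
  (fun k x => (1 - cutoff k.+1%:R x)%:E) (cst 1) (cst 1).
- move=> k; apply/measurable_EFinP; apply: measurable_funB => //.
  exact: measurable_cutoff.
- exact: measurable_cst.
- apply: aeW => x _; apply: cvg_near_cst; near=> k => /=.
  rewrite cutoff_eq0 ?subr0//; apply: (@le_trans _ _ k%:R); last by rewrite ler_nat.
  by near: k; exact: nbhs_infty_ger.
- exact: finite_measure_integrable_cst.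
- apply: aeW => x k _ /=.
  by rewrite lee_fin ger0_norm ?subr_ge0 ?cutoff_le1// gerBl cutoff_ge0.
by move=> _ _; rewrite integral_cst// mul1e.
Unshelve. all: by end_near. Qed.

(** Applied to the two Jordan parts separately; both limits are finite, so they can be
    subtracted. *)
Lemma cvg_charge_integral_cutoffC (mu : {charge set E -> \bar R}) :
  charge_integral mu (fun x => 1 - cutoff k.+1%:R x)%R @[k --> \oo] --> mu setT.
Proof.
rewrite /charge_integral; case: cid => P exQ; case: cid => Q muPQ.
rewrite (jordan_decomp muPQ)// /cadd /= cscaleN1.
apply: cvgeB; last 2 first.
- exact: (@cvg_integral_cutoffC (jordan_pos muPQ)).
- exact: (@cvg_integral_cutoffC (jordan_neg muPQ)).
by rewrite fin_num_adde_defl// fin_numN; exact: fin_num_measure.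
Qed.

Section mass.
Variable g : (E -> \bar R)^nat.
Hypothesis g0 : forall n x, 0 <= g n x.
Hypothesis mg : forall n, measurable_fun [set: E] (g n).

Let tail (r : R) := limn_esup (fun n => \int[leb]_(x in ~` @eball R N r) g n x).

Let tail_nonincreasing : nonincreasing_fun tail.
Proof.
move=> r r' rr'; apply: le_limn_esup; apply: nearW => n.
apply: ge0_subset_integral => //.
- by apply: measurableC; exact: measurable_eball.
- by apply: measurableC; exact: measurable_eball.
- exact: measurable_funTS.
- exact/subsetC/subset_eball.
Qed.

(** The tails are nonincreasing in the radius, so their limit exists and equals their infimum. The
    next three lemmas are read off from this infimum. *)
Lemma cvg_mass_at_infinity : tail r @[r --> +oo%R] --> mass_at_infinity g.
Proof.
have h := nonincreasing_cvge tail_nonincreasing.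
by rewrite (_ : mass_at_infinity g = ereal_inf (range tail))//; exact: cvg_lim h.
Qed.

Lemma mass_at_infinity_le r : mass_at_infinity g <= tail r.
Proof.
have h := nonincreasing_cvge tail_nonincreasing.
rewrite (_ : mass_at_infinity g = ereal_inf (range tail)).
  by apply: ereal_inf_lbound; exists r.
exact: cvg_lim h.
Qed.

Lemma mass_at_infinity_lt (m : \bar R) : mass_at_infinity g < m ->
  exists r, limn_esup (fun n => \int[leb]_(x in ~` @eball R N r) g n x) < m.
Proof.
have h := nonincreasing_cvge tail_nonincreasing.
rewrite (_ : mass_at_infinity g = ereal_inf (range tail)); last exact: cvg_lim h.
by move=> /ereal_inf_lt[_ [r _ <-]] rm; exists r.
Qed.

Lemma mass_at_infinity_ge0 : 0 <= mass_at_infinity g.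
Proof.
have h := nonincreasing_cvge tail_nonincreasing.
rewrite (_ : mass_at_infinity g = ereal_inf (range tail)); last exact: cvg_lim h.
apply: le_ereal_inf_tmp => _ [r _ <-].
rewrite -[leLHS](limn_esup_cst (0 : \bar R)).
by apply: le_limn_esup; apply: nearW => n; exact: integral_ge0.
Qed.

End mass.

(* The cutoffs at radii [r] and [2 N r] trap the mass outside the cutoff between
   the masses outside two balls. *)
Lemma limn_esup_integral_mass (g : (E -> \bar R)^nat)
    (mu : {charge set E -> \bar R}) :
  (0 < N)%N -> (forall n x, 0 <= g n x) -> weak_star_cvg g mu ->
  limn_esup (fun n => \int[leb]_x g n x) = mu setT + mass_at_infinity g.
Proof.
move=> N0 g0 [ig gmu].
have mg n : measurable_fun [set: E] (g n) by exact: measurable_int (ig n).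
pose tail (r : R) := limn_esup (fun n => \int[leb]_(x in ~` @eball R N r) g n x).
pose I (k : nat) := charge_integral mu (fun x => 1 - cutoff k.+1%:R x)%R.
have Ik k : I k \is a fin_num.
  rewrite /I /charge_integral; case: cid => P exQ; case: cid => Q muPQ.
  have fin (m : {finite_measure set E -> \bar R}) :
      \int[m]_x (1 - cutoff k.+1%:R x)%:E \is a fin_num.
    rewrite ge0_fin_numE; last first.
      by apply: integral_ge0 => x _; rewrite lee_fin subr_ge0 cutoff_le1.
    apply: (@le_lt_trans _ _ (\int[m]_x (cst 1 x))).
      apply: ge0_le_integral => //.
      - by move=> x _; rewrite lee_fin subr_ge0 cutoff_le1.
      - apply/measurable_EFinP; apply: measurable_funB => //.
        exact: measurable_cutoff.
      - by move=> x _; rewrite lee_fin gerBl cutoff_ge0.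
    by rewrite integral_cst// mul1e ltey_eq fin_num_measure.
  by rewrite fin_numB !fin.
have mcut k : measurable_fun [set: E] (fun x => (cutoff k.+1%:R x)%:E).
  by apply/measurable_EFinP; exact: measurable_cutoff.
(* The integrals against the test function converge to the finite number [I k], which can therefore
   be taken out of the upper limit. *)
have split_int k : limn_esup (fun n => \int[leb]_x g n x) =
    I k + limn_esup (fun n => \int[leb]_x ((cutoff k.+1%:R x)%:E * g n x)).
  have cvgI : \int[leb]_x ((1 - cutoff k.+1%:R x)%:E * g n x) @[n --> \oo] -->
      (fine (I k))%:E.
    rewrite fineK//; apply: gmu => e e0.
    (* A function in [C_c] serves as its own approximation in the definition of [C_0]. *)
    exists (fun x => 1 - cutoff k.+1%:R x)%R; first exact: C_c_cutoffC.
    by move=> x; rewrite subrr normr0 ltW.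
  rewrite -(fineK (Ik k)) -(cvg_limn_esupD _ cvgI); congr limn_esup.
  apply/funext => n; rewrite -ge0_integralD//.
  - apply: eq_integral => x _.
    rewrite -ge0_muleDl ?lee_fin ?subr_ge0 ?cutoff_le1 ?cutoff_ge0//.
    by rewrite -EFinD subrK mul1e.
  - by move=> x _; rewrite mule_ge0// lee_fin subr_ge0 cutoff_le1.
  - apply: emeasurable_funM => //; apply/measurable_EFinP.
    by apply: measurable_funB => //; exact: measurable_cutoff.
  - by move=> x _; rewrite mule_ge0// lee_fin cutoff_ge0.
  - exact: emeasurable_funM.
have cutE k n : \int[leb]_x ((cutoff k.+1%:R x)%:E * g n x) <=
    \int[leb]_(x in ~` @eball R N k.+1%:R) g n x.
  rewrite [leRHS]integral_mkcond; apply: ge0_le_integral => //.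
  - by move=> x _; rewrite mule_ge0// lee_fin cutoff_ge0.
  - exact: emeasurable_funM.
  - apply/(measurable_restrictT _ _).1; last exact: measurable_funTS.
    by apply: measurableC; exact: measurable_eball.
  - move=> x _; rewrite patchE; case: ifPn => [_|]; last first.
      rewrite notin_setE => /contrapT xk.
      have [->|/cutoff_neq0] := eqVneq (cutoff k.+1%:R x : R) 0%R; last first.
        by move=> /(_ (ltr0Sn _ _)).
      by rewrite mul0e.
    by rewrite -[leRHS]mul1e lee_wpmul2r// lee_fin cutoff_le1.
have cutE' k n : \int[leb]_(x in ~` @eball R N (2 * N%:R * k.+1%:R)) g n x <=
    \int[leb]_x ((cutoff k.+1%:R x)%:E * g n x).
  rewrite [leLHS]integral_mkcond; apply: ge0_le_integral => //.
  - by move=> x _; apply: erestrict_ge0.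
  - apply/(measurable_restrictT _ _).1; last exact: measurable_funTS.
    by apply: measurableC; exact: measurable_eball.
  - exact: emeasurable_funM.
  - move=> x _; rewrite patchE; case: ifPn => [|_].
      by rewrite inE => /cutoff_eq1_eball ->//; rewrite mul1e.
    by rewrite mule_ge0// lee_fin cutoff_ge0.
(* Radii proportional to [k + 1] give the same limit; [a] is [1] for the upper bound and [2 * N] for
   the lower one. *)
have cvgk (a : R) : (0 < a)%R -> tail (a * k.+1%:R)%R @[k --> \oo] --> mass_at_infinity g.
  move=> a0; apply: (cvg_comp _ _ _ (cvg_mass_at_infinity g0 mg)).
  apply/cvgryPge => A; near=> k.
  rewrite -ler_pdivrMl//; apply: (@le_trans _ _ k%:R); last by rewrite ler_nat.
  by near: k; exact: nbhs_infty_ger.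
have Icvg := @cvg_charge_integral_cutoffC mu.
have muT : mu setT \is a fin_num by exact: fin_num_measure.
have ub : limn_esup (fun n => \int[leb]_x g n x) <= mu setT + mass_at_infinity g.
  have c : I k + tail (1 * k.+1%:R)%R @[k --> \oo] --> mu setT + mass_at_infinity g.
    by apply: cvgeD => //; [rewrite fin_num_adde_defr|exact: cvgk].
  rewrite -(cvg_lim _ c)//; apply: lime_ge; first by apply/cvg_ex; eexists; exact: c.
  apply: nearW => k; rewrite (split_int k) leeD2l// mul1r.
  by apply: le_limn_esup; exact: nearW.
apply/eqP; rewrite eq_le ub /=.
have N20 : (0 < 2 * N%:R :> R)%R by rewrite mulr_gt0 ?ltr0n.
have c : I k + tail (2 * N%:R * k.+1%:R)%R @[k --> \oo] --> mu setT + mass_at_infinity g.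
  by apply: cvgeD => //; [rewrite fin_num_adde_defr|exact: cvgk].
rewrite -(cvg_lim _ c)//; apply: lime_le; first by apply/cvg_ex; eexists; exact: c.
apply: nearW => k; rewrite (split_int k) leeD2l//.
by apply: le_limn_esup; exact: nearW.
Unshelve. all: by end_near. Qed.

End concentration_at_infinity.

(** * Integrals of the kernels over dyadic shells *)

Section shells.
Context (R : realType) (N : nat).
Local Notation E := 'rV[R]_N.
Local Notation leb := (lebesgue_rV R N).

Lemma measurable_enormB :
  measurable_fun [set: E * E] (fun z => enorm (z.1 - z.2)).
Proof.
apply: measurableT_comp; first exact: measurable_enorm.
apply: measurable_fun_coordP => i.
rewrite (_ : (fun _ => _) = (fun z : E * E => z.1 ord0 i - z.2 ord0 i)); last first.
  by apply/funext => z; rewrite !mxE.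
apply: measurable_funB.
- exact: measurableT_comp (measurable_coord i) measurable_fst.
- exact: measurableT_comp (measurable_coord i) measurable_snd.
Qed.

Lemma measurable_enormBr (x : E) :
  measurable_fun [set: E] (fun y => enorm (x - y)).
Proof.
exact: (measurable_fun_pair2 x measurable_enormB).
Qed.

Lemma measurable_eball_at (x : E) r : measurable [set y : E | enorm (x - y) < r].
Proof.
rewrite (_ : [set _ | _] = (fun y => enorm (x - y)) @^-1` `]-oo, r[).
  by rewrite -[X in measurable X]setTI; exact: measurable_enormBr.
by apply/seteqP; split=> y; rewrite /= in_itv.
Qed.

(** The ball lies in the cube of side [2 * r] centered at [x]. *)
Lemma lebesgue_rV_eball_le (x : E) r : 0 < r ->
  (leb [set y | enorm (x - y)%R < r]%R <= ((2 * r) ^+ N)%:E)%E.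
Proof.
move=> r0.
pose A (i : 'I_N) : set R := `]x ord0 i - r, x ord0 i + r[%classic.
have mA i : measurable (A i) by exact: measurable_itv.
have boxE : leb [set y : E | forall i, A i (y ord0 i)] = ((2 * r) ^+ N)%:E.
  rewrite lebesgue_rV_box//.
  rewrite (eq_bigr (fun=> (2 * r)%:E)) ?prodEFin ?prodr_const ?card_ord// => i _.
  rewrite lebesgue_measure_itv/= lte_fin ltrD2l gtrN// -EFinB.
  by congr EFin; lra.
apply: (@le_trans _ _ (leb [set y : E | forall i, A i (y ord0 i)])).
  apply: le_measure; rewrite ?inE.
  - exact: measurable_eball_at.
  - rewrite (_ : [set y : E | forall i, A i (y ord0 i)] =
        \bigcap_(i in [set: 'I_N]) ((fun y : E => y ord0 i) @^-1` A i)); last first.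
      by apply/seteqP; split=> y /= h i; [move=> _|]; exact: h.
    apply: fin_bigcap_measurable => // i _.
    by rewrite -[X in measurable X]setTI; exact: measurable_coord.
  - move=> y /= xy i; rewrite /A/= in_itv/= -ltr_distlC.
    by apply: le_lt_trans xy; have := coord_le_enorm (x - y) i; rewrite !mxE.
by rewrite boxE.
Qed.

Lemma powRX (a e : R) k : 0 <= a -> (a ^+ k) `^ e = (a `^ e) ^+ k.
Proof. by move=> a0; rewrite -!powR_mulrn ?powR_ge0// powRAC. Qed.

Lemma le0_ger_powR (e u v : R) : e <= 0 -> 0 < u -> u <= v -> v `^ e <= u `^ e.
Proof.
move=> e0 u0 uv; have v0 := lt_le_trans u0 uv.
rewrite -[e]opprK (powRN v (- e)) (powRN u (- e)) lef_pV2 ?posrE ?powR_gt0//.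
by apply: ge0_ler_powR; rewrite ?nnegrE ?oppr_ge0// ltW.
Qed.

Lemma integral_shells (h : R -> R) (l t a : R) (x : E) :
  measurable_fun [set: R] h -> (forall d, 0 <= h d) ->
  0 < l -> 0 < t -> t `^ a < 1 -> a < N%:R ->
  (forall d, h d <= d `^ (a - N%:R)) ->
  (forall d, 0 <= d -> h d != 0 -> exists k, l * t ^+ k <= d < 2 * (l * t ^+ k)) ->
  (\int[leb]_y (h (enorm (x - y)))%:E <= (4 ^+ N * l `^ a / (1 - t `^ a))%R%:E)%E.
Proof.
move=> mh h0 l0 t0 ta1 aN hle hsupp.
have lk0 k : 0 < l * t ^+ k by rewrite mulr_gt0// exprn_gt0.
pose B k : set E := [set y | enorm (x - y) < 2 * (l * t ^+ k)].
pose w k := (l * t ^+ k) `^ (a - N%:R).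
have mB k : measurable (B k) by exact: measurable_eball_at.
pose f k (y : E) : \bar R := ((w k)%:E * (\1_(B k) y)%:E)%E.
have f0 k y : (0 <= f k y)%E.
  by rewrite /f -EFinM lee_fin mulr_ge0// powR_ge0.
have mf k : measurable_fun [set: E] (f k).
  by apply: measurable_funeM; apply/measurable_EFinP; exact: measurable_indic.
have mhx : measurable_fun [set: E] (fun y => (h (enorm (x - y)))%:E).
  apply/measurable_EFinP; apply: (measurableT_comp mh).
  exact: measurable_enormBr.
apply: (@le_trans _ _ (\int[leb]_y (\sum_(k <oo) f k y))%E).
  apply: ge0_le_integral => //.
  - by move=> y _; rewrite lee_fin.
  - by apply: ge0_emeasurable_sum => // k y _ _; exact: f0.
  - move=> y _; have [->|/(hsupp _ (enorm_ge0 _))[k /andP[k1 k2]]] := eqVneq (h (enorm (x - y))) 0.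
      by apply: nneseries_ge0 => // k _ _; exact: f0.
    apply: (@le_trans _ _ (f k y)).
      rewrite /f indicE mem_set//= mule1 lee_fin (le_trans (hle _))//.
      by rewrite /w; apply: le0_ger_powR => //; rewrite subr_le0 ltW.
    apply: (@le_trans _ _ (\sum_(0 <= i < k.+1) f i y)%E); last first.
      by apply: nneseries_lim_ge => i _ _; exact: f0.
    by rewrite big_nat_recr//= leeDr// sume_ge0.
rewrite integral_nneseries//.
have fk k : (\int[leb]_y f k y <= (4 ^+ N * l `^ a * (t `^ a) ^+ k)%:E)%E.
  rewrite ge0_integralZl//; last 2 first.
  - by apply/measurable_EFinP; exact: measurable_indic.
  - by rewrite lee_fin powR_ge0.
  rewrite integral_indic// setIT.
  apply: (@le_trans _ _ ((w k)%:E * ((2 * (2 * (l * t ^+ k))) ^+ N)%:E)%E).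
    by rewrite lee_pmul2l ?lte_fin ?powR_gt0//; apply: lebesgue_rV_eball_le; rewrite mulr_gt0.
  set L := l * t ^+ k; have L0 : 0 < L by exact: lk0.
  have Ln0 : L != 0 by rewrite gt_eqF.
  have wE : w k * L ^+ N = l `^ a * (t `^ a) ^+ k.
    rewrite /w -/L powRB ?Ln0 ?implybT// powR_mulrn ?divfK ?expf_neq0// ?ltW//.
    by rewrite powRM ?exprn_ge0 ?ltW// powRX ?ltW.
  rewrite -EFinM lee_fin -mulrA -wE mulrA -natrM exprMn.
  by rewrite mulrCA.
apply: (@le_trans _ _ (\sum_(k <oo) (4 ^+ N * l `^ a * (t `^ a) ^+ k)%:E)%E).
  by apply: lee_nneseries => // k _ _; apply: integral_ge0 => y _; exact: f0.
apply: lime_le.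
  apply: is_cvg_nneseries => k _ _.
  by rewrite lee_fin !mulr_ge0 ?exprn_ge0 ?powR_ge0.
apply: nearW => n; rewrite sumEFin lee_fin.
have := @geometric_le_lim R n (4 ^+ N * l `^ a) (t `^ a).
by apply; rewrite ?mulr_ge0 ?exprn_ge0 ?powR_gt0 ?powR_ge0// ger0_norm ?powR_ge0.
Qed.

Lemma powR_half_lt1 (a : R) : 0 < a -> 2^-1 `^ a < 1.
Proof.
move=> a0; have one : 1 `^ a = 1 by rewrite powR1.
rewrite -[ltRHS]one.
have h : 2^-1 < 1 :> R by lra.
by apply: gt0_ltr_powR h; rewrite ?nnegrE// invr_ge0.
Qed.

Lemma dyadic_below (l d : R) : 0 < d -> exists k, l * 2^-1 ^+ k <= d.
Proof.
move=> d0; have : l * 2^-1 ^+ k @[k --> \oo] --> l * 0.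
  apply: cvgMl_tmp; apply: cvg_expr; rewrite ger0_norm; lra.
rewrite mulr0 => /cvgrPdist_le/(_ d d0)[k _ /(_ k (leqnn k))].
by rewrite sub0r normrN => kd; exists k; apply: le_trans kd; exact: ler_norm.
Qed.

(* The dyadic shells are [2^-(k+1) rho <= |x - y| < 2^-k rho]. *)
Lemma integral_near_kernel (rho a : R) (x : E) : 0 < rho -> 0 < a < N%:R ->
  (\int[leb]_y (if enorm (x - y) < rho then enorm (x - y) `^ (a - N%:R) else 0)%R%:E
   <= (4 ^+ N * (rho / 2) `^ a / (1 - 2^-1 `^ a))%R%:E)%E.
Proof.
move=> rho0 /andP[a0 aN].
apply: (@integral_shells (fun d => if d < rho then d `^ (a - N%:R) else 0)).
- apply: measurable_fun_ifT => //; exact: measurable_fun_ltr.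
- by move=> d; case: ifPn => // _; rewrite powR_ge0.
- by rewrite divr_gt0.
- by rewrite invr_gt0.
- exact: powR_half_lt1.
- exact: aN.
- by move=> d; case: ifPn => // _; rewrite powR_ge0.
- move=> d d0; case: ifPn => [drho|_]; last by rewrite eqxx.
  have [->|dn0 _] := eqVneq d 0; first by rewrite powR0 ?eqxx// subr_eq0 lt_eqF.
  have {}d0 : 0 < d by rewrite lt_neqAle eq_sym dn0.
  have ex := dyadic_below (rho / 2) d0.
  (* The least admissible index gives the right shell: were [d] beyond its outer radius, the
     preceding index would do, and for index [0] the outer radius is [rho]. *)
  case: (ex_minnP ex) => k kd kmin; exists k; rewrite kd /=.
  case: k => [|k] in kd kmin *; first by rewrite expr0 mulr1 mulrC divfK.
  rewrite ltNge; apply/negP => /= dk.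
  suff /kmin : rho / 2 * 2^-1 ^+ k <= d by rewrite ltnn.
  apply: le_trans dk; rewrite exprS.
  by set X := _ ^+ k; lra.
Qed.

(* The dyadic shells are [2^k rho <= |x - y| < 2^(k+1) rho]. *)
Lemma integral_far_kernel (rho a : R) (x : E) : 0 < rho -> 0 < a ->
  (\int[leb]_y (if rho <= enorm (x - y) then enorm (x - y) `^ (- a - N%:R) else 0)%R%:E
   <= (4 ^+ N * rho `^ (- a) / (1 - 2^-1 `^ a))%R%:E)%E.
Proof.
move=> rho0 a0.
(* The shells now grow with ratio [2], and the exponent of the general lemma is [- a]. *)
have -> : 2^-1 `^ a = 2 `^ (- a) :> R by rewrite -powR_inv1// -powRrM mulN1r.
apply: (@integral_shells (fun d => if rho <= d then d `^ (- a - N%:R) else 0)) => //.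
- apply: measurable_fun_ifT => //; exact: measurable_fun_ler.
- by move=> d; case: ifPn => // _; rewrite powR_ge0.
- by rewrite -[2]invrK -powR_inv1 ?invr_ge0// -powRrM mulN1r opprK powR_half_lt1.
- by apply: (@lt_le_trans _ _ 0); rewrite ?oppr_lt0.
- by move=> d; case: ifPn => // _; rewrite powR_ge0.
- move=> d d0; case: ifPn => [rhod _|_]; last by rewrite eqxx.
  have {}d0 : 0 < d by exact: lt_le_trans rhod.
  have ex : exists k, d < 2 * (rho * 2 ^+ k).
    have [k dk] := dyadic_below d rho0; exists k.
    apply: (@le_lt_trans _ _ (rho * 2 ^+ k)).
      by rewrite -ler_pdivrMr ?exprn_gt0// -exprVn.
    by rewrite ltr_pMl ?ltr1n// mulr_gt0// exprn_gt0.
  case: (ex_minnP ex) => k kd kmin; exists k; rewrite kd andbT.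
  case: k => [|k] in kd kmin *; first by rewrite expr0 mulr1.
  rewrite leNgt; apply/negP => dk.
  suff /kmin : d < 2 * (rho * 2 ^+ k) by rewrite ltnn.
  by apply: (lt_le_trans dk); rewrite exprS mulrCA.
Qed.

End shells.

(** * Elementary bounds on the exponents *)

Section powR_facts.
Context (R : realType).
Implicit Types (a b e x y P : R).

(** Either [b <= e * a] or [a <= e^-1 * b], and the larger summand absorbs the other. The constants
    carry the exponent [P] to be uniform in [x]; for small [e] the first is close to [1]. *)
Lemma powRD_le_split a b e x P : 0 <= a -> 0 <= b -> 0 < e -> 0 <= x <= P ->
  (a + b) `^ x <= (1 + e) `^ P * a `^ x + (1 + e^-1) `^ P * b `^ x.
Proof.
move=> a0 b0 e0 /andP[x0 xP].
have mono c d : 0 <= c -> 0 < d -> a + b <= (1 + d) * c ->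
    (a + b) `^ x <= (1 + d) `^ P * c `^ x.
  move=> c0 d0 abc; have d1 : 0 <= 1 + d by rewrite addr_ge0// ltW.
  apply: (@le_trans _ _ (((1 + d) * c) `^ x)).
    by apply: ge0_ler_powR; rewrite // nnegrE ?mulr_ge0// addr_ge0.
  by rewrite powRM// ler_wpM2r ?powR_ge0// ler_powR// lerDl ltW.
have [bea|/ltW aeb] := leP b (e * a).
  apply: (le_trans (mono a e _ _ _)) => //; first by rewrite mulrDl mul1r lerD2l.
  by rewrite lerDl mulr_ge0 ?powR_ge0.
apply: (le_trans (mono b e^-1 _ _ _)) => //; first by rewrite invr_gt0.
  by rewrite mulrDl mul1r addrC lerD2l ler_pdivlMl.
by rewrite lerDr mulr_ge0 ?powR_ge0.
Qed.

Lemma powR_le_add1 a x P : 0 <= a -> 0 <= x <= P -> a `^ x <= a `^ P + 1.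
Proof.
move=> a0 /andP[x0 xP]; have [a1|/ltW a1] := leP 1 a.
  by rewrite (le_trans (ler_powR a1 xP))// lerDl.
apply: (@le_trans _ _ 1); last by rewrite lerDr powR_ge0.
have <- : 1 `^ x = 1 by rewrite powR1.
by apply: ge0_ler_powR; rewrite // nnegrE.
Qed.

(* The exponents are those of [|x - y|^p / |x - y|^(N + s p)]. *)
Lemma kernel_quotient_le d rho s n x P : 0 < d <= rho -> 1 <= rho -> 0 < s < 1 ->
  1 <= x <= P -> d `^ x / d `^ (n + s * x) <= rho `^ P * d `^ ((1 - s) - n).
Proof.
move=> /andP[d0 drho] rho1 /andP[s0 s1] /andP[x1 xP].
have dn0 : d != 0 by rewrite gt_eqF.
rewrite -powRB ?dn0 ?implybT//.
have -> : x - (n + s * x) = (1 - s) * (x - 1) + ((1 - s) - n) by ring.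
rewrite powRD ?dn0 ?implybT// ler_wpM2r ?powR_ge0//.
have e0 : 0 <= (1 - s) * (x - 1) by rewrite mulr_ge0 ?subr_ge0 // ltW.
apply: (@le_trans _ _ (rho `^ ((1 - s) * (x - 1)))).
  by apply: ge0_ler_powR; rewrite // nnegrE ltW// (lt_le_trans d0).
rewrite ler_powR//; apply: (@le_trans _ _ (1 * (x - 1))).
  by rewrite ler_wpM2r ?subr_ge0// gerBl ltW.
by rewrite mul1r lerBlDr (le_trans xP)// lerDl.
Qed.

End powR_facts.

(** * Consequences of the conditions on the variable exponent *)

Section exponent_facts.
Context (R : realType) (N : nat) (s : R) (p : 'rV[R]_N -> 'rV[R]_N -> R).
Local Notation E := 'rV[R]_N.
Local Notation leb := (lebesgue_rV R N).
Hypothesis hs : 0 < s < 1.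
Hypothesis hP : condP2 s p.

Lemma condP2_sym x y : p x y = p y x.
Proof. by have [_ + _ _ _] := hP. Qed.

Lemma condP2_le_pbar x y : p x y <= pbar p.
Proof.
have [_ _ [_ ub _ _] _ _] := hP.
by apply: ub_le_sup => //; exists (x, y).
Qed.

Lemma condP2_pinf_le x y : pinf p <= p x y.
Proof.
have [_ _ [lb _ _ _] _ _] := hP.
by apply: ge_inf => //; exists (x, y).
Qed.

Lemma condP2_gt1 x y : 1 < p x y.
Proof.
by have [_ _ [_ _ + _] _ _] := hP; move/lt_le_trans; apply; exact: condP2_pinf_le.
Qed.

Lemma pbar_gt1 : 1 < pbar p.
Proof. exact: lt_le_trans (condP2_gt1 0 0) (condP2_le_pbar 0 0). Qed.

(** For [N = 0] the upper bound [N / s] would force [pbar p] to be negative. *)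
Lemma condP2_dim_gt0 : (0 < N)%N.
Proof.
have [_ _ [_ _ _ ps] _ _] := hP.
have := lt_trans pbar_gt1 ps; case: posnP => // ->.
by rewrite mul0r ltr10.
Qed.

Lemma condP2_continuous : continuous (fun z : E * E => p z.1 z.2).
Proof. by have [uc _ _ _ _] := hP; exact: unif_continuous_continuous. Qed.

Lemma measurable_condP2 : measurable_fun [set: E * E] (fun z => p z.1 z.2).
Proof. apply: continuous_measurable_rV2; exact: condP2_continuous. Qed.

(** Since [pbar p] bounds [p] from above, an infimum different from it needs a value below it. The
    union of sections is open by continuity of [p], which settles measurability although the union
    is uncountable. *)
Lemma plow_neq_pbarE :
  [set x | plow p x <> pbar p] = \bigcup_y [set x | p x y < pbar p].
Proof.
have lb x : has_lbound (range (p x)).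
  by exists (pinf p) => _ [y _ <-]; exact: condP2_pinf_le.
have ple x y : plow p x <= p x y by apply: ge_inf => //; exists y.
apply/seteqP; split=> x /=; last first.
  by move=> [y _ /= pxy] e; have := ple x y; rewrite e leNgt pxy.
apply: contra_notP => h; apply/eqP; rewrite eq_le (le_trans (ple x 0))//=; last first.
  exact: condP2_le_pbar.
apply: lb_le_inf; first by exists (p x 0), 0.
move=> _ [y _ <-]; rewrite leNgt; apply/negP => pxy; apply: h.
by exists y.
Qed.

Lemma measurable_plow_neq_pbar : measurable [set x | plow p x <> pbar p].
Proof.
apply: open_measurable_rV; rewrite plow_neq_pbarE; apply: bigcup_open => y _.
have c : continuous (fun x => p x y).
  apply: unif_continuous_continuous; apply/unif_continuousP => e e0.
  have [+ _ _ _ _] := hP; move=> /unif_continuousP/(_ e e0)[d d0 pd].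
  exists d => // -[x x'] /= xx'; apply: (pd ((x, y), (x', y))) => /=.
  by split => //=; exact: ballxx.
apply: (@open_comp _ _ (fun x => p x y) [set t | t < pbar p]).
  by move=> x _; exact: c.
exact: open_lt.
Qed.

(** Where the exponent is below [pbar p], the point [x] is in the exceptional set and the indicator
    adds the [1] that pays for raising the exponent. *)
Lemma powR_exponent_le (w : R) x y : 0 <= w ->
  w `^ p x y <= w `^ pbar p + \1_[set x | plow p x <> pbar p] x.
Proof.
move=> w0; have [pxy|pxy] := ltP (p x y) (pbar p).
  rewrite indicE mem_set.
    by rewrite powR_le_add1// condP2_le_pbar ltW// (lt_trans _ (condP2_gt1 x y)).
  by rewrite plow_neq_pbarE; exists y.
have -> : p x y = pbar p by apply/eqP; rewrite eq_le condP2_le_pbar.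
by rewrite lerDl indicE; case: (_ \in _).
Qed.

End exponent_facts.

(** * The modular of a truncation *)

Section truncated_modular.
Context (R : realType) (N : nat) (s : R) (p : 'rV[R]_N -> 'rV[R]_N -> R).
Local Notation E := 'rV[R]_N.
Local Notation leb := (lebesgue_rV R N).
Local Notation P := (pbar p).
Local Notation A := [set x | plow p x <> pbar p].
Hypothesis hs : 0 < s < 1.
Hypothesis hP : condP2 s p.

(** [lam] is the scale at which the modular is evaluated; [lam = 1] gives the truncated function
    itself. *)
Definition truncation (r lam : R) (u : E -> R) (x : E) : R :=
  cutoff r x * u x / lam.

(* Dominates [|u x| ^ p x y] for all [y]; it is integrable because the set where the
   exponent can differ from its supremum has finite measure. *)
Definition pow_dominator (u : E -> R) (x : E) : R := `|u x| `^ P + \1_A x.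

(** The near part comes from the Lipschitz bound on the cutoff, whence the factor [1 / r]. The far
    part uses that exponents are at least [1], so that the kernel decays at least like the power
    [- s - N] once [rho >= 1]. *)
Definition error_kernel (rho r : R) (x y : E) : R :=
  rho `^ P / r *
    (if enorm (x - y) < rho then enorm (x - y) `^ ((1 - s) - N%:R) else 0) +
  (if rho <= enorm (x - y) then enorm (x - y) `^ (- s - N%:R) else 0).

Lemma pow_dominator_ge0 u x : 0 <= pow_dominator u x.
Proof. by rewrite addr_ge0 ?powR_ge0// indicE; case: (_ \in _). Qed.

Lemma error_kernel_ge0 rho r x y : 0 < r -> 0 <= error_kernel rho r x y.
Proof.
move=> r0; rewrite addr_ge0//; last by case: ifP; rewrite ?powR_ge0.
apply: mulr_ge0; first by rewrite divr_ge0 ?powR_ge0 ?ltW.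
by case: ifP; rewrite ?powR_ge0.
Qed.

Lemma error_kernelC rho r x y : error_kernel rho r x y = error_kernel rho r y x.
Proof. by rewrite /error_kernel enormB. Qed.

(** Far pairs go entirely into the error term. Near pairs are split by the product rule, and only
    the difference of [u] weighted by the cutoff at [x] feeds the main term. [theta] is asked to
    dominate only near pairs with [x] outside the ball; elsewhere the crude bound [L] is enough. *)
Lemma truncation_pointwise (u : E -> R) (lam r rho e theta L : R) x y :
  0 < lam -> 1 <= r -> 1 <= rho -> 0 < e -> 0 <= theta -> 
  lam^-1 `^ p x y <= L ->
  (~ eball r x -> enorm (x - y) < rho ->
    (1 + e) `^ P * lam^-1 `^ p x y <= theta) ->
  `|truncation r lam u x - truncation r lam u y| `^ p x y /
    enorm (x - y) `^ (N%:R + s * p x y) <=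
  theta * \1_(~` @eball R N r) x *
    (`|u x - u y| `^ p x y / enorm (x - y) `^ (N%:R + s * p x y)) +
  L * (2 `^ P + (1 + e^-1) `^ P) *
    ((pow_dominator u x + pow_dominator u y) * error_kernel rho r x y).
Proof.
move=> lam0 r1 rho1 e0 theta0 lamL lamtheta.
have r0 : 0 < r by exact: lt_le_trans r1.
have q1 : 1 < p x y by exact: (condP2_gt1 hP).
have q0 : 0 < p x y by exact: lt_trans q1.
have qP : p x y <= P := condP2_le_pbar hP x y.
have qb : 0 <= p x y <= P by rewrite qP ltW.
have Ux : `|u x| `^ p x y <= pow_dominator u x by apply: (powR_exponent_le hP).
have Uy : `|u y| `^ p x y <= pow_dominator u y.
  by rewrite (condP2_sym hP); apply: (powR_exponent_le hP).
have [s0 s1] := andP hs.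
have q0W := ltW q0; have r0W := ltW r0.
set q := p x y in q0W q1 q0 qP qb Ux Uy lamL lamtheta *.
set d := enorm (x - y) in lamtheta *.
have d0 : 0 <= d by exact: enorm_ge0.
set b := lam^-1 `^ q in lamL lamtheta *.
have b0 : 0 <= b by exact: powR_ge0.
have L0 : 0 <= L by exact: le_trans lamL.
set C := 2 `^ P + (1 + e^-1) `^ P.
have C0 : 0 <= C by rewrite addr_ge0 ?powR_ge0.
have X0 := @error_kernel_ge0 rho r x y r0.
have W0 : 0 <= pow_dominator u x + pow_dominator u y.
  by rewrite addr_ge0 ?pow_dominator_ge0.
have ind0 : 0 <= \1_(~` @eball R N r) x :> R by rewrite indicE; case: (_ \in _).
have rhs0 : 0 <= theta * \1_(~` @eball R N r) x * (`|u x - u y| `^ q / d `^ (N%:R + s * q)).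
  by rewrite !mulr_ge0 ?invr_ge0 ?powR_ge0.
(* On the diagonal the numerator is [0] to a positive power, hence [0]. *)
have [dE|dn0] := eqVneq d 0.
  have xy : x = y.
    apply/eqP; rewrite -subr_eq0 -normr_le0 -dE; exact: norm_le_enorm.
  rewrite {1}xy subrr normr0 powR0 ?gt_eqF// mul0r addr_ge0//.
  by rewrite !mulr_ge0.
have dW := d0; have {d0 dn0}d0 : 0 < d by rewrite lt_neqAle eq_sym dn0.
pose w z := cutoff r z * u z.
have -> : `|truncation r lam u x - truncation r lam u y| `^ q = `|w x - w y| `^ q * b.
  rewrite /truncation -mulrBl normrM powRM ?normr_ge0//.
  by rewrite (gtr0_norm (_ : 0 < lam^-1)) ?invr_gt0.
have k0 : 0 < d `^ (N%:R + s * q) by rewrite powR_gt0.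
have wu z : `|w z| <= `|u z|.
  by rewrite normrM ler_piMl// ger0_norm ?cutoff_ge0// cutoff_le1.
have [rhod|drho] := leP rho d.
  have errE : error_kernel rho r x y = d `^ (- s - N%:R).
    by rewrite /error_kernel -/d rhod ltNge rhod /= mulr0 add0r.
  have num : `|w x - w y| `^ q <= C * (pow_dominator u x + pow_dominator u y).
    apply: (@le_trans _ _ ((`|u x| + `|u y|) `^ q)).
      apply: ge0_ler_powR; rewrite ?nnegrE ?addr_ge0//.
      by apply: (le_trans (ler_normB _ _)); exact: lerD.
    apply: (le_trans (powRD_le_split _ _ ltr01 qb)) => //.
    rewrite invr1 -[1 + 1]/(2%:R) -mulrDr; apply: ler_pM.
    - exact: powR_ge0.
    - by rewrite addr_ge0 ?powR_ge0.
    - by rewrite lerDl powR_ge0.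
    - exact: lerD.
  (* Here [d >= rho >= 1] and [N + s * q >= N + s], so the smaller exponent gives the larger
     quotient. *)
  have den : (d `^ (N%:R + s * q))^-1 <= d `^ (- s - N%:R).
    rewrite -powRN ler_powR ?(le_trans rho1)//.
    rewrite opprD addrC lerD2r lerN2 -[leLHS]mulr1 ler_wpM2l ?ltW//.
  apply: ler_wpDl; rewrite // errE.
  rewrite mulrAC (_ : L * C * _ =
    C * (pow_dominator u x + pow_dominator u y) * d `^ (- s - N%:R) * L); last by ring.
  apply: ler_pM => //; first by rewrite mulr_ge0 ?powR_ge0// invr_ge0 ltW.
  by apply: ler_pM => //; rewrite ?powR_ge0// invr_ge0 ltW.
have errE : error_kernel rho r x y = rho `^ P / r * d `^ ((1 - s) - N%:R).
  by rewrite /error_kernel -/d drho leNgt drho /= addr0.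
have B0 : 0 <= `|u y| * (d / r) by rewrite mulr_ge0// divr_ge0.
have wxy : `|w x - w y| `^ q <= (1 + e) `^ P * (\1_(~` @eball R N r) x * `|u x - u y| `^ q) +
    (1 + e^-1) `^ P * (`|u y| * (d / r)) `^ q.
  have wE : w x - w y = cutoff r x * (u x - u y) + u y * (cutoff r x - cutoff r y).
    by rewrite /w; ring.
  have lip : `|u y * (cutoff r x - cutoff r y)| <= `|u y| * (d / r).
    rewrite normrM ler_wpM2l//; apply: (le_trans (cutoff_lip _ _ r0)).
    by rewrite ler_pM2r ?invr_gt0// norm_le_enorm.
  (* Where the cutoff vanishes at [x] the first summand is absent; this is what allows the indicator
     in front of it. *)
  have [c0|cn0] := eqVneq (cutoff r x) 0.
    rewrite wE c0 mul0r add0r; rewrite c0 in lip.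
    apply: ler_wpDl; first by rewrite !mulr_ge0 ?powR_ge0.
    apply: (@le_trans _ _ ((`|u y| * (d / r)) `^ q)).
      by apply: ge0_ler_powR => //; rewrite nnegrE.
    rewrite ler_peMl ?powR_ge0// -[leLHS](powRr0 (1 + e^-1)) ler_powR//.
      by rewrite lerDl invr_ge0 ltW.
    by rewrite (le_trans (ltW q0)).
  rewrite indicE mem_set; last exact: cutoff_neq0 cn0.
  rewrite mul1r.
  apply: (@le_trans _ _ ((`|u x - u y| + `|u y| * (d / r)) `^ q)).
    apply: ge0_ler_powR; rewrite ?nnegrE ?addr_ge0//.
    rewrite wE; apply: (le_trans (ler_normD _ _)); apply: lerD => //.
    by rewrite normrM ler_piMl// ger0_norm ?cutoff_ge0// cutoff_le1.
  by apply: powRD_le_split => //; rewrite mulr_ge0 ?divr_ge0// ltW.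
have second : (`|u y| * (d / r)) `^ q / d `^ (N%:R + s * q) <=
    pow_dominator u y * error_kernel rho r x y.
  rewrite powRM//; last by rewrite divr_ge0.
  rewrite -mulrA; apply: ler_pM; [exact: powR_ge0| |exact: Uy|].
    by rewrite divr_ge0 ?powR_ge0.
  rewrite errE powRM//; last by rewrite invr_ge0.
  rewrite mulrAC (mulrAC _ r^-1).
  apply: ler_pM; [by rewrite divr_ge0 ?powR_ge0|exact: powR_ge0| |].
    by apply: kernel_quotient_le; rewrite // ?d0 ltW.
  (* As [r >= 1] and [q >= 1], the power of [1 / r] is at most [1 / r] itself, whatever the
     exponent. *)
  rewrite -[leRHS]powRr1 ?invr_ge0//; apply: ger_powR; last exact: ltW.
  by rewrite invr_gt0 r0 invf_le1.
have first_le : \1_(~` @eball R N r) x * ((1 + e) `^ P * b) <= theta * \1_(~` @eball R N r) x.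
  rewrite indicE; have [|_] := boolP (x \in _); last by rewrite mul0r mulr0.
  by rewrite inE mul1r mulr1 => xr; exact: lamtheta.
set i := \1_(~` @eball R N r) x in ind0 rhs0 wxy first_le *.
have kV0 : 0 <= (d `^ (N%:R + s * q))^-1 by rewrite invr_ge0 ltW.
apply: (@le_trans _ _ (i * ((1 + e) `^ P * b) * (`|u x - u y| `^ q / d `^ (N%:R + s * q)) +
    b * (1 + e^-1) `^ P * ((`|u y| * (d / r)) `^ q / d `^ (N%:R + s * q)))).
  have := ler_wpM2r (mulr_ge0 b0 kV0) wxy; rewrite mulrA => /le_trans; apply.
  by rewrite le_eqVlt; apply/orP; left; apply/eqP; ring.
apply: lerD; first by rewrite ler_wpM2r// mulr_ge0 ?powR_ge0.
apply: ler_pM; rewrite ?mulr_ge0 ?powR_ge0//.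
  by apply: ler_pM; rewrite ?powR_ge0// lerDr powR_ge0.
apply: (le_trans second); rewrite ler_wpM2r// lerDr; exact: pow_dominator_ge0.
Qed.

End truncated_modular.

Lemma measurable_fun_powR2 d (T : measurableType d) (R : realType)
    (f g : T -> R) : measurable_fun setT f -> measurable_fun setT g ->
  measurable_fun setT (fun x => f x `^ g x).
Proof.
move=> mf mg; rewrite /powR; apply: measurable_fun_ifT.
- exact: measurable_fun_eqr.
- apply: (measurableT_comp (f := fun b : bool => b%:R : R)) => //.
  exact: measurable_fun_eqr.
- apply: measurableT_comp => //; apply: measurable_funM => //.
  exact: measurableT_comp.
Qed.

(** * Measurability and total mass of the error kernel *)

Section truncated_modular_integral.
Context (R : realType) (N : nat) (s : R) (p : 'rV[R]_N -> 'rV[R]_N -> R).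
Local Notation E := 'rV[R]_N.
Local Notation leb := (lebesgue_rV R N).
Local Notation P := (pbar p).
Hypothesis hs : 0 < s < 1.
Hypothesis hP : condP2 s p.

(** The constants of the two shell estimates, for the exponents [1 - s] and [s], with the powers of
    the radius removed. *)
Definition near_mass : R := 4 ^+ N / (1 - 2^-1 `^ (1 - s)).
Definition far_mass : R := 4 ^+ N / (1 - 2^-1 `^ s).
Definition error_mass (rho r : R) : R :=
  rho `^ P / r * ((rho / 2) `^ (1 - s) * near_mass) + rho `^ (- s) * far_mass.

Lemma near_mass_ge0 : 0 <= near_mass.
Proof.
have [s0 s1] := andP hs.
by rewrite divr_ge0 ?exprn_ge0// subr_ge0 ltW// powR_half_lt1// subr_gt0.
Qed.

Lemma far_mass_ge0 : 0 <= far_mass.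
Proof.
have [s0 s1] := andP hs.
by rewrite divr_ge0 ?exprn_ge0// subr_ge0 ltW// powR_half_lt1.
Qed.

Lemma error_mass_ge0 rho r : 0 <= r -> 0 <= error_mass rho r.
Proof.
move=> r0; have nm := near_mass_ge0; have fm := far_mass_ge0.
apply: addr_ge0; last by rewrite mulr_ge0 ?powR_ge0.
by rewrite mulr_ge0 ?divr_ge0 ?powR_ge0// mulr_ge0 ?powR_ge0.
Qed.

Lemma measurable_error_kernel rho r :
  measurable_fun [set: E * E] (fun z => error_kernel s p rho r z.1 z.2).
Proof.
have md := @measurable_enormB R N.
have mpow (a : R) : measurable_fun [set: E * E] (fun z => enorm (z.1 - z.2) `^ a).
  exact: measurableT_comp (@measurable_powR R a) md.
apply: measurable_funD.
  apply: measurable_funM => //; apply: measurable_fun_ifT => //.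
  exact: measurable_fun_ltr.
apply: measurable_fun_ifT => //; exact: measurable_fun_ler.
Qed.

Lemma integral_error_kernel rho r x : 1 <= rho -> 1 <= r ->
  (\int[leb]_y (error_kernel s p rho r x y)%:E <= (error_mass rho r)%:E)%E.
Proof.
move=> rho1 r1; have [s0 s1] := andP hs.
have rho0 : 0 < rho by exact: lt_le_trans rho1.
have r0 : 0 < r by exact: lt_le_trans r1.
have N0 := condP2_dim_gt0 hP.
have md := measurable_enormBr x.
have mpow (a : R) : measurable_fun [set: E] (fun y => enorm (x - y) `^ a).
  exact: measurableT_comp (@measurable_powR R a) md.
rewrite /error_kernel; under eq_integral do rewrite EFinD EFinM.
rewrite ge0_integralD//; last 4 first.
- move=> y _; rewrite -EFinM lee_fin mulr_ge0 ?divr_ge0 ?powR_ge0 ?(ltW r0)//.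
  by case: ifP; rewrite ?powR_ge0.
- apply: measurable_funeM; apply/measurable_EFinP; apply: measurable_fun_ifT => //.
  exact: measurable_fun_ltr.
- by move=> y _; case: ifP; rewrite lee_fin ?powR_ge0.
- apply/measurable_EFinP; apply: measurable_fun_ifT => //; exact: measurable_fun_ler.
rewrite ge0_integralZl//; last 3 first.
- apply/measurable_EFinP; apply: measurable_fun_ifT => //; exact: measurable_fun_ltr.
- by move=> y _; case: ifP; rewrite lee_fin ?powR_ge0.
- by rewrite lee_fin divr_ge0 ?powR_ge0 ?(ltW r0).
rewrite [in leRHS]/error_mass EFinD [X in (_ <= X + _)%E]EFinM; apply: leeD.
  apply: lee_wpmul2l; first by rewrite lee_fin divr_ge0 ?powR_ge0 ?(ltW r0).
  have aN : 0 < 1 - s < N%:R.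
    by rewrite subr_gt0 s1/= (@lt_le_trans _ _ 1) ?ler1n// gtrBl.
  apply: (le_trans (integral_near_kernel x rho0 aN)).
  by rewrite lee_fin /near_mass mulrCA mulrA.
apply: (le_trans (integral_far_kernel x rho0 s0)).
by rewrite lee_fin /far_mass mulrCA mulrA.
Qed.

(** The order of choices matters: [rho] makes the far part small, then [r] beats the near part,
    whose coefficient grows with [rho]. *)
Lemma error_mass_small (eps : R) : 0 < eps ->
  exists2 rho, 1 <= rho & exists2 r0, 1 <= r0 &
    forall r, r0 <= r -> error_mass rho r <= eps.
Proof.
move=> eps0; have [s0 s1] := andP hs.
have e20 : 0 < eps / 2 by rewrite divr_gt0.
pose c := 1 + far_mass / (eps / 2).
have c1 : 1 <= c by rewrite lerDl divr_ge0 ?far_mass_ge0 ?(ltW e20).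
have c0 : 0 < c by exact: lt_le_trans c1.
pose rho := c `^ s^-1.
have rho1 : 1 <= rho.
  by rewrite -[leLHS](powRr0 c) ler_powR// invr_ge0 ltW.
exists rho => //.
pose D := rho `^ P * ((rho / 2) `^ (1 - s) * near_mass).
have D0 : 0 <= D.
  by rewrite mulr_ge0 ?powR_ge0// mulr_ge0 ?powR_ge0 ?near_mass_ge0.
exists (1 + D / (eps / 2)) => [|r rD].
  by rewrite lerDl divr_ge0 ?(ltW e20).
have r0 : 0 < r.
  by apply: lt_le_trans rD; rewrite ltr_pwDl// divr_ge0 ?(ltW e20).
rewrite [leRHS]splitr; apply: lerD.
  rewrite mulrAC -/D ler_pdivrMr// mulrC -ler_pdivrMr//.
  by apply: le_trans rD; rewrite lerDr.
rewrite /rho -powRrM mulrN mulVf ?gt_eqF// powR_inv1 ?(ltW c0)//.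
rewrite mulrC ler_pdivrMr// mulrC -ler_pdivrMr//.
by rewrite /c lerDr.
Qed.

Lemma measurable_pow_dominator (u : E -> R) : measurable_fun [set: E] u ->
  measurable_fun [set: E] (pow_dominator p u).
Proof.
move=> mu; apply: measurable_funD.
  apply: (measurableT_comp (@measurable_powR R _)).
  exact: measurableT_comp.
apply: measurable_indic; exact: (measurable_plow_neq_pbar hP).
Qed.

Lemma measurable_gagliardo_integrand (u : E -> R) : measurable_fun [set: E] u ->
  measurable_fun [set: E * E] (fun z => `|u z.1 - u z.2| `^ p z.1 z.2 /
    enorm (z.1 - z.2) `^ (N%:R + s * p z.1 z.2)).
Proof.
move=> mu; have mp := measurable_condP2 hP.
apply: measurable_funM.
  apply: measurable_fun_powR2 => //; apply: measurableT_comp => //.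
  apply: measurable_funB.
    exact: measurableT_comp mu measurable_fst.
  exact: measurableT_comp mu measurable_snd.
under eq_fun do rewrite -powRN; apply: measurable_fun_powR2.
  exact: measurable_enormB.
apply: measurableT_comp => //; apply: measurable_funD => //.
exact: measurable_funM.
Qed.

End truncated_modular_integral.

(** * The integrated modular estimate *)

Section W_modular_truncation.
Context (R : realType) (N : nat) (s : R) (p : 'rV[R]_N -> 'rV[R]_N -> R).
Local Notation E := 'rV[R]_N.
Local Notation leb := (lebesgue_rV R N).
Local Notation P := (pbar p).
Hypothesis hs : 0 < s < 1.
Hypothesis hP : condP2 s p.

Let G (u : E -> R) (z : E * E) : R := `|u z.1 - u z.2| `^ p z.1 z.2 /
    enorm (z.1 - z.2) `^ (N%:R + s * p z.1 z.2).

Let G0 u z : 0 <= G u z.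
Proof. by rewrite divr_ge0 ?powR_ge0. Qed.

Lemma gagliardo_ge0 (u : E -> R) x : (0 <= gagliardo s p u x)%E.
Proof. by apply: integral_ge0 => y _; rewrite lee_fin divr_ge0 ?powR_ge0. Qed.

Lemma measurable_gagliardo (u : E -> R) : measurable_fun [set: E] u ->
  measurable_fun [set: E] (gagliardo s p u).
Proof.
move=> mu.
have mG : measurable_fun [set: E * E] (EFin \o G u).
  by apply/measurable_EFinP; exact: measurable_gagliardo_integrand.
apply: (@measurable_fun_fubini_tonelli_F _ _ _ _ _ leb _ mG) => z.
by rewrite lee_fin.
Qed.

Lemma measurable_abs_powR (u : E -> R) (a : R) : measurable_fun [set: E] u ->
  measurable_fun [set: E] (fun x => (`|u x| `^ a)%:E).
Proof.
move=> mu; apply/measurable_EFinP.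
apply: (measurableT_comp (@measurable_powR R a)); exact: measurableT_comp.
Qed.

Lemma energy_density_ge0 (u : E -> R) x : (0 <= energy_density s p u x)%E.
Proof. by rewrite adde_ge0 ?gagliardo_ge0// lee_fin powR_ge0. Qed.

Lemma W_modularE (u : E -> R) : measurable_fun [set: E] u ->
  W_modular s p u = (\int[leb]_x energy_density s p u x)%E.
Proof.
move=> mu; rewrite /W_modular /energy_density [RHS]ge0_integralD//.
- exact: measurable_abs_powR.
- by move=> x _; exact: gagliardo_ge0.
- exact: measurable_gagliardo.
Qed.

Lemma integral_pow_dominator (u : E -> R) : measurable_fun [set: E] u ->
  (\int[leb]_x (pow_dominator p u x)%:E =
   \int[leb]_x (`|u x| `^ P)%:E + leb [set x | plow p x <> pbar p])%E.
Proof.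
move=> mu; have mA := measurable_plow_neq_pbar hP.
rewrite /pow_dominator; under eq_integral do rewrite EFinD.
rewrite ge0_integralD//.
- by rewrite integral_indic// setIT.
- exact: measurable_abs_powR.
- by apply/measurable_EFinP; exact: measurable_indic.
Qed.

Lemma measurable_truncation (r lam : R) (u : E -> R) : 0 < r ->
  measurable_fun [set: E] u -> measurable_fun [set: E] (truncation r lam u).
Proof.
move=> r0 mu; apply: measurable_funM => //.
by apply: measurable_funM => //; exact: measurable_cutoff.
Qed.

(** By Tonelli and the symmetry of the kernel, both summands have the same integral; hence the
    factor [2]. *)
Lemma integral_error_le (u : E -> R) (rho r : R) : measurable_fun [set: E] u ->
  1 <= rho -> 1 <= r ->
  (\int[leb \x leb]_z ((pow_dominator p u z.1 + pow_dominator p u z.2) *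
      error_kernel s p rho r z.1 z.2)%:E <=
   (2 * error_mass s p rho r)%:E * \int[leb]_x (pow_dominator p u x)%:E)%E.
Proof.
move=> mu rho1 r1; have r0 : 0 < r by exact: lt_le_trans r1.
have mU := measurable_pow_dominator hP mu.
have mK := measurable_error_kernel s p rho r.
have m1 : measurable_fun [set: E * E] (fun z =>
    (pow_dominator p u z.1 * error_kernel s p rho r z.1 z.2)%:E).
  apply/measurable_EFinP; apply: measurable_funM => //.
  exact: measurableT_comp mU measurable_fst.
have m2 : measurable_fun [set: E * E] (fun z =>
    (pow_dominator p u z.2 * error_kernel s p rho r z.1 z.2)%:E).
  apply/measurable_EFinP; apply: measurable_funM => //.
  exact: measurableT_comp mU measurable_snd.
have U0 := @pow_dominator_ge0 R N p.
have K0 x y := @error_kernel_ge0 R N s p rho r x y r0.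
under eq_integral do rewrite mulrDl EFinD.
rewrite ge0_integralD//; last 2 first.
- by move=> z _; rewrite lee_fin mulr_ge0.
- by move=> z _; rewrite lee_fin mulr_ge0.
have mKx x : measurable_fun [set: E] (fun y => (error_kernel s p rho r x y)%:E).
  by apply/measurable_EFinP; exact: (measurable_fun_pair2 x mK).
have one x : (\int[leb]_y (pow_dominator p u x * error_kernel s p rho r x y)%:E <=
    (error_mass s p rho r)%:E * (pow_dominator p u x)%:E)%E.
  under eq_integral do rewrite EFinM.
  rewrite ge0_integralZl//; last 2 first.
  - by move=> y _; rewrite lee_fin.
  - by rewrite lee_fin.
  by rewrite muleC lee_wpmul2r ?lee_fin// integral_error_kernel.
have em0 : 0 <= error_mass s p rho r by rewrite error_mass_ge0// ltW.
have bound : (\int[leb]_x \int[leb]_y (pow_dominator p u x * error_kernel s p rho r x y)%:E <=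
    (error_mass s p rho r)%:E * \int[leb]_x (pow_dominator p u x)%:E)%E.
  rewrite -ge0_integralZl//; last 2 first.
  - exact/measurable_EFinP.
  - by move=> y _; rewrite lee_fin.
  apply: ge0_le_integral => //.
  - by move=> x _; apply: integral_ge0 => y _; rewrite lee_fin mulr_ge0.
  - apply: (@measurable_fun_fubini_tonelli_F _ _ _ _ _ leb _ m1) => z.
    by rewrite lee_fin mulr_ge0.
  - by apply: measurable_funeM; exact/measurable_EFinP.
rewrite mulr_natl mulr2n EFinD ge0_muleDl ?lee_fin//; apply: leeD.
  by rewrite fubini_tonelli1// => z; rewrite lee_fin mulr_ge0.
have pos2 (z : E * E) :
    (0 <= (pow_dominator p u z.2 * error_kernel s p rho r z.1 z.2)%:E)%E.
  by rewrite lee_fin mulr_ge0.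
rewrite (@fubini_tonelli2 _ _ _ _ _ leb leb _ m2 pos2).
apply: le_trans bound; rewrite le_eqVlt; apply/orP; left; apply/eqP.
apply: eq_integral => y _; apply: eq_integral => x _.
by rewrite error_kernelC.
Qed.

(** Integration of the pointwise bound; the indicator depends on [x] alone and turns the main term
    into a tail of the energy. The separate condition on the power [P] of [lam^-1] serves the
    Lebesgue part of the modular. *)
Lemma W_modular_truncation_le (u : E -> R) (lam r rho e theta L : R) :
  measurable_fun [set: E] u ->
  0 < lam -> 1 <= r -> 1 <= rho -> 0 < e -> 0 <= theta ->
  (forall x y, lam^-1 `^ p x y <= L) ->
  lam^-1 `^ P <= theta ->
  (forall x y, ~ eball r x -> enorm (x - y) < rho ->
    (1 + e) `^ P * lam^-1 `^ p x y <= theta) ->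
  (W_modular s p (truncation r lam u) <=
   theta%:E * \int[leb]_(x in ~` @eball R N r) energy_density s p u x +
   (L * (2 `^ P + (1 + e^-1) `^ P) * (2 * error_mass s p rho r))%:E *
   \int[leb]_x (pow_dominator p u x)%:E)%E.
Proof.
move=> mu lam0 r1 rho1 e0 theta0 HL HP Htheta.
have r0 : 0 < r by exact: lt_le_trans r1.
have mv := measurable_truncation lam r0 mu.
have mB : measurable (~` @eball R N r) by apply: measurableC; exact: measurable_eball.
have P0 : P != 0 by rewrite gt_eqF// (lt_trans ltr01)// (pbar_gt1 hP).
have U0 := @pow_dominator_ge0 R N p.
have K0 x y := @error_kernel_ge0 R N s p rho r x y r0.
set C := L * _.
have L0 : 0 <= L by apply: le_trans (HL 0 0); exact: powR_ge0.
have C0 : 0 <= C by rewrite mulr_ge0// addr_ge0 ?powR_ge0.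
set Q := [set: E * E].
pose H1 (z : E * E) : R := theta * \1_(~` @eball R N r) z.1 * G u z.
pose H2 (z : E * E) : R := (pow_dominator p u z.1 + pow_dominator p u z.2) *
   error_kernel s p rho r z.1 z.2.
have mH1 : measurable_fun Q (EFin \o H1).
  apply/measurable_EFinP; apply: measurable_funM; last exact: measurable_gagliardo_integrand.
  apply: measurable_funM => //.
  have mI : measurable_fun [set: E] (\1_(~` @eball R N r) : E -> R).
    exact: measurable_indic.
  exact: measurableT_comp mI measurable_fst.
have mU := measurable_pow_dominator hP mu.
have mH2 : measurable_fun Q (EFin \o H2).
  apply/measurable_EFinP; apply: measurable_funM; last exact: measurable_error_kernel.
  apply: measurable_funD.
    exact: measurableT_comp mU measurable_fst.
  exact: measurableT_comp mU measurable_snd.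
have H10 z : 0 <= H1 z.
  by rewrite mulr_ge0// mulr_ge0// indicE; case: (_ \in _).
have H20 z : 0 <= H2 z by rewrite mulr_ge0// addr_ge0.
have mGv : measurable_fun Q (EFin \o G (truncation r lam u)).
  by apply/measurable_EFinP; exact: measurable_gagliardo_integrand.
have gagl : (\int[leb]_x gagliardo s p (truncation r lam u) x <=
    \int[leb \x leb]_z (H1 z)%:E + C%:E * \int[leb \x leb]_z (H2 z)%:E)%E.
  rewrite -ge0_integralZl//; last by move=> z _; rewrite lee_fin.
  rewrite -ge0_integralD//; last 3 first.
  - by move=> z _; rewrite lee_fin.
  - by move=> z _; rewrite -EFinM lee_fin mulr_ge0.
  - exact: measurable_funeM.
  rewrite (_ : (\int[leb]_x gagliardo s p (truncation r lam u) x)%E =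
     (\int[leb \x leb]_z (G (truncation r lam u) z)%:E)%E); last first.
    by rewrite fubini_tonelli1// => z; rewrite lee_fin.
  apply: ge0_le_integral => //.
  - by move=> z _; rewrite lee_fin.
  - by apply: emeasurable_funD => //; exact: measurable_funeM.
  - move=> [x y] _; rewrite -EFinM -EFinD lee_fin.
    by apply: truncation_pointwise => //; exact: Htheta.
have H1E : (\int[leb \x leb]_z (H1 z)%:E =
    theta%:E * \int[leb]_(x in ~` @eball R N r) gagliardo s p u x)%E.
  rewrite fubini_tonelli1//.
  rewrite [in RHS]integral_mkcond -ge0_integralZl//; last 2 first.
  - apply/(measurable_restrictT _ _).1 => //; apply: measurable_funTS.
    exact: measurable_gagliardo.
  - by move=> x _; apply: erestrict_ge0 => y _; exact: gagliardo_ge0.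
  apply: eq_integral => x _; rewrite /fubini_F /H1 /=.
  under eq_integral do rewrite EFinM.
  rewrite ge0_integralZl//; last 3 first.
  - have mGu : measurable_fun Q (EFin \o G u).
      by apply/measurable_EFinP; exact: measurable_gagliardo_integrand.
    exact: (measurable_fun_pair2 x mGu).
  - by move=> y _; rewrite lee_fin.
  - by rewrite lee_fin mulr_ge0// indicE; case: (_ \in _).
  rewrite patchE indicE; case: (x \in _); first by rewrite mulr1.
  by rewrite mulr0 mul0e mule0.
have powv : (\int[leb]_x (`|truncation r lam u x| `^ P)%:E <=
    theta%:E * \int[leb]_(x in ~` @eball R N r) (`|u x| `^ P)%:E)%E.
  rewrite [in leRHS]integral_mkcond -ge0_integralZl//; last 2 first.
  - apply/(measurable_restrictT _ _).1 => //; apply: measurable_funTS.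
    exact: measurable_abs_powR.
  - by move=> x _; apply: erestrict_ge0 => y _; rewrite lee_fin powR_ge0.
  apply: ge0_le_integral => //.
  - exact: measurable_abs_powR.
  - apply: measurable_funeM; apply/(measurable_restrictT _ _).1 => //.
    by apply: measurable_funTS; exact: measurable_abs_powR.
  - move=> x _; rewrite patchE; case: ifPn => [_|].
      rewrite -EFinM lee_fin /truncation normrM powRM//.
      rewrite mulrC (gtr0_norm (_ : 0 < lam^-1)) ?invr_gt0//.
      apply: ler_pM; rewrite ?powR_ge0//.
      apply: ge0_ler_powR; rewrite ?nnegrE//.
        by rewrite ltW// (lt_trans ltr01)// (pbar_gt1 hP).
      by rewrite normrM ler_piMl// ger0_norm ?cutoff_ge0// cutoff_le1.
    (* Inside the ball the truncation vanishes, and [0] to the nonzero power [P] is [0]. *)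
    rewrite notin_setE => /contrapT xr.
    have -> : truncation r lam u x = 0.
      have [c0|/cutoff_neq0] := eqVneq (cutoff r x) 0; last by move=> /(_ r0).
      by rewrite /truncation c0 !mul0r.
    by rewrite normr0 powR0// mule0.
apply: (@le_trans _ _ (theta%:E * \int[leb]_(x in ~` @eball R N r) (`|u x| `^ P)%:E +
   (theta%:E * \int[leb]_(x in ~` @eball R N r) gagliardo s p u x +
    C%:E * \int[leb \x leb]_z (H2 z)%:E))%E).
  by apply: leeD => //; rewrite -H1E.
rewrite addeA -ge0_muleDr; last 2 first.
- by apply: integral_ge0 => x _; rewrite lee_fin powR_ge0.
- by apply: integral_ge0 => x _; exact: gagliardo_ge0.
rewrite -ge0_integralD//; last 3 first.
- by apply: measurable_funTS; exact: measurable_abs_powR.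
- by move=> x _; exact: gagliardo_ge0.
- by apply: measurable_funTS; exact: measurable_gagliardo.
apply: leeD => //; rewrite [in leRHS]EFinM -muleA.
by apply: lee_wpmul2l => //; exact: integral_error_le.
Qed.

End W_modular_truncation.

(** * The concentration inequality *)

(** The quotient of the powers is [expR ((x - c) * ln a)]. The [1] added to the absolute value of
    [ln a] keeps the denominator positive when [a = 1]. *)
Lemma powR_near (R : realType) (a c t : R) : 0 < a -> 1 < t ->
  exists2 delta, 0 < delta &
    forall x, `|x - c| < delta -> a `^ x <= t * a `^ c.
Proof.
move=> a0 t1; have lt0 : 0 < ln t by exact: ln_gt0.
exists (ln t / (1 + `|ln a|)) => [|x]; first by rewrite divr_gt0// ltr_pwDl.
rewrite ltr_pdivlMr ?ltr_pwDl// => xc.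
rewrite -[x](subrK c) powRD; last by rewrite (gt_eqF a0) implybT.
rewrite ler_wpM2r ?powR_ge0//.
rewrite /powR gt_eqF// -[leRHS](@lnK _ t) ?posrE ?(lt_trans ltr01)// ler_expR.
apply: (le_trans (ler_norm _)); rewrite normrM; apply: le_trans (ltW xc).
by rewrite ler_wpM2l// lerDr.
Qed.

Lemma powR_1D_small (R : realType) (P t : R) : 0 < P -> 1 < t ->
  exists2 e, 0 < e & (1 + e) `^ P <= t.
Proof.
move=> P0 t1; have t0 : 0 < t by exact: lt_trans t1.
exists (t `^ P^-1 - 1).
  have one : 1 `^ P^-1 = 1 :> R by rewrite powR1.
  by rewrite subr_gt0 -[ltLHS]one gt0_ltr_powR ?nnegrE ?invr_gt0// ltW.
by rewrite addrC subrK -powRrM mulVf ?gt_eqF// powRr1// ltW.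
Qed.

(** The empty set is included: its infimum is [0] by convention. *)
Lemma pos_inf_ge0 (R : realType) (B : set R) : (forall l, B l -> 0 < l) -> 0 <= inf B.
Proof.
move=> B0; have [->|/set0P Bne] := eqVneq B set0; first by rewrite inf0.
by apply: lb_le_inf => // l /B0/ltW.
Qed.

(** * Sobolev and Luxemburg norms *)

Section norms.
Context (R : realType) (N : nat) (s : R) (p : 'rV[R]_N -> 'rV[R]_N -> R)
  (q : 'rV[R]_N -> R).
Local Notation E := 'rV[R]_N.
Local Notation leb := (lebesgue_rV R N).

Lemma W_norm_ge0 (u : E -> R) : 0 <= W_norm s p u.
Proof. by apply: pos_inf_ge0 => l []. Qed.

Lemma W_norm_le (u : E -> R) lam : 0 < lam ->
  (W_modular s p (fun x => u x / lam)%R < 1)%E -> W_norm s p u <= lam.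
Proof.
by move=> lam0 h; apply: ge_inf => //; exists 0 => l [/ltW].
Qed.

(* If [S_q] is positive, the Luxemburg norm of a nonzero function is the infimum
   of a nonempty set, and not the junk value [0]. *)
Lemma Lq_modular_le1 (v : E -> R) (kap : R) :
  0 < S_q s p q -> inW s p v -> ~ {ae leb, forall x, v x = 0} ->
  W_norm s p v < kap * S_q s p q ->
  exists2 l, 0 < l < kap & (\int[leb]_x (`|v x / l| `^ q x)%:E <= 1)%E.
Proof.
move=> S0 vW v0 vkap; set W := W_norm s p v in vkap *.
have W0 : 0 <= W by exact: W_norm_ge0.
have SWL : S_q s p q <= W / Lq_norm q v.
  apply: ge_inf; last by exists v.
  exists 0 => _ [w _ <-]; rewrite divr_ge0 ?W_norm_ge0//.
  by apply: pos_inf_ge0 => l [].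
have L0 : 0 < Lq_norm q v.
  rewrite ltNge; apply/negP => L0; move: (lt_le_trans S0 SWL).
  by rewrite ltNge mulr_ge0_le0// invr_le0.
move: SWL; rewrite ler_pdivlMr// => SWL.
have Lkap : Lq_norm q v < kap by rewrite -(ltr_pM2l S0) (le_lt_trans SWL)// mulrC.
have ne : [set l : R | 0 < l /\ (\int[leb]_x (`|v x / l| `^ q x)%:E <= 1)%E] !=set0.
  apply/set0P/eqP => e; move: L0.
  by rewrite /Lq_norm e inf0 ltxx.
have [l [l0 lq] lkap] := inf_lt ne Lkap.
by exists l => //; rewrite l0.
Qed.

End norms.

(** * Tail estimates uniform in the function *)

Section tails.
Context (R : realType) (N : nat) (s : R) (p : 'rV[R]_N -> 'rV[R]_N -> R)
  (q : 'rV[R]_N -> R).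
Local Notation E := 'rV[R]_N.
Local Notation leb := (lebesgue_rV R N).
Local Notation P := (pbar p).
Hypothesis hs : 0 < s < 1.
Hypothesis hP : condP2 s p.

Lemma inW_energy_lty (u : E -> R) : inW s p u ->
  (\int[leb]_x energy_density s p u x < +oo)%E.
Proof.
by move=> [mu u1 u2]; rewrite -(W_modularE hP)// /W_modular lte_add_pinfty.
Qed.

Lemma integral_tail_le (g : E -> \bar R) r : measurable_fun [set: E] g ->
  (forall x, 0 <= g x)%E ->
  (\int[leb]_(x in ~` @eball R N r) g x <= \int[leb]_x g x)%E.
Proof.
move=> mg g0; apply: ge0_subset_integral => //.
by apply: measurableC; exact: measurable_eball.
Qed.

Lemma measurable_energy_density (u : E -> R) : measurable_fun [set: E] u ->
  measurable_fun [set: E] (energy_density s p u).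
Proof.
move=> mu; apply: emeasurable_funD; first exact: measurable_abs_powR.
exact: measurable_gagliardo.
Qed.

Lemma plow_neq_pbar_lty : (leb [set x | plow p x <> pbar p] < +oo)%E.
Proof. by have [_ _ _ _] := hP. Qed.

(** Only finiteness is wanted, so the modular estimate is used with all of [lam], [rho] and [e]
    equal to [1]. *)
Lemma inW_truncation (u : E -> R) r : 1 <= r -> inW s p u ->
  inW s p (truncation r 1 u).
Proof.
move=> r1 uW; have [mu u1 u2] := uW.
have r0 : 0 < r by exact: lt_le_trans r1.
have mv := measurable_truncation 1 r0 mu.
suff : (W_modular s p (truncation r 1 u) < +oo)%E.
  move=> h; split; [exact: mv| |]; apply: le_lt_trans h; rewrite /W_modular.
    by rewrite leeDl// integral_ge0// => x _; exact: gagliardo_ge0.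
  by rewrite leeDr// integral_ge0// => x _; rewrite lee_fin powR_ge0.
have one a : 1^-1 `^ a = 1 :> R by rewrite invr1 powR1.
have H1 x y : 1^-1 `^ p x y <= 1 :> R by rewrite one.
have H2 : 1^-1 `^ P <= (1 + 1) `^ P.
  rewrite one -[leLHS](powRr0 (1 + 1)) ler_powR ?lerDl//.
  by rewrite ltW// (lt_trans ltr01)// (pbar_gt1 hP).
have H3 x y : ~ eball r x -> enorm (x - y) < 1 ->
    (1 + 1) `^ P * 1^-1 `^ p x y <= (1 + 1) `^ P by rewrite one mulr1.
apply: le_lt_trans (W_modular_truncation_le hs hP mu ltr01 r1 (lexx 1) ltr01
  (powR_ge0 _ _) H1 H2 H3) _.
rewrite lte_add_pinfty// lte_mul_pinfty ?lee_fin ?powR_ge0//.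
- apply: le_lt_trans (inW_energy_lty uW); apply: integral_tail_le.
    exact: measurable_energy_density.
  by move=> x; exact: energy_density_ge0.
- rewrite mul1r mulr_ge0 ?addr_ge0 ?powR_ge0//.
  by rewrite mulr_ge0// (error_mass_ge0 p hs)// ltW.
- by rewrite (integral_pow_dominator hP)// lte_add_pinfty// plow_neq_pbar_lty.
Qed.

(** The radius depends on [u] only through the bounds [m] and [B], so it will serve a whole sequence
    at once. The main term of the modular is at most [theta * m < 1], and the error must fit into
    the gap. *)
Lemma truncation_norm_le (lam m : R) (B : R) :
  p z.1 z.2 @[z --> (@einfty R N, @einfty R N)] --> P ->
  0 < lam -> 0 < m -> m < lam `^ P -> 0 <= B ->
  exists2 r0, 1 <= r0 & forall r (u : E -> R), r0 <= r -> inW s p u ->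
    (\int[leb]_(x in ~` @eball R N r) energy_density s p u x <= m%:E)%E ->
    (\int[leb]_x (`|u x| `^ P)%:E <= B%:E)%E ->
    W_norm s p (truncation r 1 u) <= lam.
Proof.
move=> hp lam0 m0 mlam B0.
have P1 := pbar_gt1 hP; have P0 : 0 < P by exact: lt_trans P1.
have N0 := condP2_dim_gt0 hP.
have lamV0 : 0 < lam^-1 by rewrite invr_gt0.
have lamP0 : 0 < lam `^ P by rewrite powR_gt0.
(* The room between [1] and [lam]^ P / m[is halved. The square root]t[of]T[is spent once on](1 + e)
   [^ P] and once on replacing the exponent [p x y] by [P]. *)
pose T := (1 + lam `^ P / m) / 2.
have lamPm : 1 < lam `^ P / m by rewrite ltr_pdivlMr ?mul1r.
have T1 : 1 < T by rewrite /T; lra.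
have Tlam : T < lam `^ P / m by rewrite /T; lra.
pose t := T `^ 2^-1.
have t1 : 1 < t.
  have one : 1 `^ 2^-1 = 1 :> R by rewrite powR1.
  by rewrite -[ltLHS]one gt0_ltr_powR ?nnegrE ?invr_gt0// ltW// (lt_trans ltr01).
have tt : t * t = T.
  rewrite /t -powRD; last by rewrite (gt_eqF (lt_trans ltr01 T1)) implybT.
  rewrite (_ : 2^-1 + 2^-1 = 1) ?powRr1//; last by lra.
  by rewrite ltW// (lt_trans ltr01).
have [e e0 et] := powR_1D_small P0 t1.
have [delta delta0 pdelta] := powR_near P lamV0 t1.
pose theta := T * lam^-1 `^ P.
have theta0 : 0 <= theta by rewrite mulr_ge0 ?powR_ge0// ltW// (lt_trans ltr01).
have lamVP : lam^-1 `^ P = (lam `^ P)^-1.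
  by rewrite -powR_inv1 ?(ltW lam0)// -powRrM mulN1r powRN.
have thetam : theta * m < 1.
  rewrite /theta lamVP mulrAC ltr_pdivrMr// mul1r.
  by rewrite -ltr_pdivlMr.
pose L := lam^-1 `^ P + 1.
have HL x y : lam^-1 `^ p x y <= L.
  apply: powR_le_add1; first exact: ltW.
  by rewrite (condP2_le_pbar hP) andbT ltW// (lt_trans ltr01)// (condP2_gt1 hP).
have A_fin : leb [set x | plow p x <> pbar p] \is a fin_num.
  by rewrite ge0_fin_numE// plow_neq_pbar_lty.
pose a := fine (leb [set x | plow p x <> pbar p]).
have a0 : 0 <= a by rewrite fine_ge0.
pose C := L * (2 `^ P + (1 + e^-1) `^ P).
have L0 : 0 <= L by rewrite addr_ge0 ?powR_ge0.
have C0 : 0 <= C by rewrite mulr_ge0// addr_ge0 ?powR_ge0.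
(* The error then uses at most half of the gap; the [1] in the denominator keeps it positive. *)
pose eps := (1 - theta * m) / 2 / (1 + C * 2 * (B + a)).
have D0 : 0 <= C * 2 * (B + a).
  by apply: mulr_ge0; [exact: mulr_ge0|exact: addr_ge0].
have D1 : 0 < 1 + C * 2 * (B + a) by rewrite ltr_pwDl.
have eps0 : 0 < eps by rewrite divr_gt0 ?divr_gt0 ?subr_gt0.
have [rho rho1 [r1 r11 rerr]] := error_mass_small p hs eps0.
have [M HM] : exists M : R, forall x y : E, M < enorm x -> M < enorm y ->
    `|p x y - P| < delta.
  have [/= [Q1 Q2] /= [[M1 _ HM1] [M2 _ HM2]] sub] := hp _ (nbhsx_ballx P delta delta0).
  exists (Num.max M1 M2) => x y; rewrite !gt_max => /andP[x1 _] /andP[_ y2].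
  have := sub (x, y) (conj (HM1 x x1) (HM2 y y2)).
  by rewrite /= -ball_normE /= distrC.
(* Beyond this Euclidean radius the sup norm is at least [|M| + 1 + rho], so points within [rho] are
   still beyond [M]. *)
pose r2 := N%:R * (`|M| + 1 + rho).
have NR : 1 <= N%:R :> R by rewrite ler1n.
have rho0 : 0 < rho by exact: lt_le_trans rho1.
exists (Num.max r1 r2) => [|r u]; first by rewrite le_max r11.
rewrite ge_max => /andP[rr1 rr2] uW um uB.
have [mu _ _] := uW.
have rge1 : 1 <= r by exact: le_trans rr1.
apply: W_norm_le => //.
have -> : (fun x => truncation r 1 u x / lam) = truncation r lam u.
  by apply/funext => x; rewrite /truncation divr1.
apply: le_lt_trans (@W_modular_truncation_le R N s p hs hP u lam r rho e theta L
  mu lam0 rge1 rho1 e0 theta0 HL _ _) _.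
- by rewrite /theta ler_peMl ?powR_ge0// ltW.
- move=> x y /negP; rewrite -leNgt => rx xy.
  apply: (@le_trans _ _ (t * (t * lam^-1 `^ P))); last by rewrite mulrA tt.
  apply: ler_pM; rewrite ?powR_ge0//; apply: pdelta.
  have normx : `|M| + 1 + rho <= `|x|.
    rewrite -(@ler_pM2l _ N%:R) ?ltr0n//.
    by apply: le_trans (enorm_le_norm x); exact: le_trans rx.
  have normy : `|M| + 1 <= `|y|.
    have : `|x| - `|y| <= `|x - y| by exact: lerB_dist.
    have := norm_le_enorm (x - y); lra.
  have MM := ler_norm M.
  apply: HM.
    have := norm_le_enorm x; lra.
  have := norm_le_enorm y; lra.
have em0 : 0 <= error_mass s p rho r by rewrite (error_mass_ge0 p hs)// (le_trans ler01).
apply: (@le_lt_trans _ _ (theta * m + C * (2 * eps) * (B + a))%:E).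
  rewrite [leRHS]EFinD; apply: leeD.
    by rewrite [leRHS]EFinM; apply: lee_wpmul2l; rewrite ?lee_fin.
  rewrite [leRHS]EFinM; apply: lee_pmul.
  - by rewrite lee_fin mulr_ge0// mulr_ge0.
  - by apply: integral_ge0 => x _; rewrite lee_fin pow_dominator_ge0.
  - by rewrite lee_fin ler_wpM2l// ler_wpM2l// rerr.
  - by rewrite (integral_pow_dominator hP)// EFinD leeD// /a fineK.
rewrite lte_fin.
have -> : C * (2 * eps) * (B + a) = eps * (C * 2 * (B + a)) by ring.
have : eps * (C * 2 * (B + a)) <= (1 - theta * m) / 2.
  rewrite /eps mulrAC ler_pdivrMr// ler_wpM2l ?lerDr//.
  by rewrite divr_ge0// subr_ge0 ltW.
lra.
Qed.

Lemma q_tail_le (qoo lam kap y : R) : unif_continuous q -> (forall x, 0 < q x) ->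
  q x @[x --> @einfty R N] --> qoo ->
  0 < S_q s p q -> 0 < kap -> lam < kap * S_q s p q -> kap `^ qoo < y ->
  exists r0 : R, forall r (u : E -> R), r0 <= r -> 1 <= r -> inW s p u ->
    W_norm s p (truncation r 1 u) <= lam ->
    (\int[leb]_(x in ~` @eball R N (2 * N%:R * r)) q_density q u x <= y%:E)%E.
Proof.
move=> uq q0 hq S0 kap0 lamkap kapy.
have kapq0 : 0 < kap `^ qoo by rewrite powR_gt0.
have y0 : 0 < y by exact: lt_trans kapy.
have t1 : 1 < y / kap `^ qoo by rewrite ltr_pdivlMr// mul1r.
have [delta delta0 qdelta] := powR_near qoo kap0 t1.
have [M _ HM] := hq _ (nbhsx_ballx qoo delta delta0).
have N0 := condP2_dim_gt0 hP.
exists (`|M| + 1) => r u rM r1 uW vlam.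
have r0 : 0 < r by exact: lt_le_trans r1.
have [mu _ _] := uW.
have mq : measurable_fun [set: E] q.
  by apply: continuous_measurable_rV; exact: unif_continuous_continuous.
have mpowq (f : E -> R) : measurable_fun [set: E] f ->
    measurable_fun [set: E] (fun x => (`|f x| `^ q x)%:E).
  move=> mf; apply/measurable_EFinP; apply: measurable_fun_powR2 => //.
  exact: measurableT_comp.
set v := truncation r 1 u in vlam.
have mv : measurable_fun [set: E] v by exact: measurable_truncation.
set D := ~` @eball R N (2 * N%:R * r).
have mD : measurable D by apply: measurableC; exact: measurable_eball.
have vE x : D x -> v x = u x.
  by move=> Dx; rewrite /v /truncation (cutoff_eq1_eball r0 N0 Dx) mul1r divr1.
(* Almost everywhere vanishing functions are excluded from the infimum [S_q]; for them the tail is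
   zero. *)
have [v0|v0] := pselect {ae leb, forall x, v x = 0}.
  rewrite (_ : (\int[leb]_(x in D) _)%E = 0%E) ?lee_fin ?(ltW y0)//.
  have -> : (\int[leb]_(x in D) q_density q u x)%E = (\int[leb]_(x in D) cst 0%E x)%E.
    apply: ae_eq_integral => //.
    - by apply: measurable_funTS; exact: mpowq.
    - apply: filterS v0 => x vx Dx /=.
      by rewrite /q_density -(vE x Dx) vx normr0 powR0// gt_eqF.
  by rewrite integral_cst// mul0e.
have vW : inW s p v by exact: inW_truncation.
have [l /andP[l0 lkap] vl] := Lq_modular_le1 S0 vW v0 (le_lt_trans vlam lamkap).
have mvl : measurable_fun [set: E] (fun x => v x / l) by exact: measurable_funM.
apply: (@le_trans _ _ (y%:E * \int[leb]_(x in D) (`|v x / l| `^ q x)%:E)%E); last first.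
  rewrite -[leRHS]mule1 lee_wpmul2l ?lee_fin ?(ltW y0)//.
  apply: le_trans vl; apply: integral_tail_le; first exact: mpowq.
  by move=> x; rewrite lee_fin powR_ge0.
rewrite -ge0_integralZl//; last 2 first.
- by apply: measurable_funTS; exact: mpowq.
- by rewrite lee_fin ltW.
apply: ge0_le_integral => //.
- by move=> x _; rewrite lee_fin powR_ge0.
- by apply: measurable_funTS; exact: mpowq.
- by apply: measurable_funeM; apply: measurable_funTS; exact: mpowq.
- move=> x Dx; rewrite -EFinM lee_fin -(vE x Dx).
  have -> : `|v x| = l * `|v x / l|.
    by rewrite (normrM (v x)) (gtr0_norm (_ : 0 < l^-1)) ?invr_gt0// mulrC divfK// gt_eqF.
  rewrite powRM ?(ltW l0)// ler_wpM2r ?powR_ge0//.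
  apply: (@le_trans _ _ (kap `^ q x)).
    by apply: ge0_ler_powR; rewrite ?nnegrE ltW.
  have -> : y = y / kap `^ qoo * kap `^ qoo by rewrite divfK// gt_eqF.
  apply: qdelta.
  have /HM : M < enorm x.
    have : 2 * N%:R * r <= enorm x by rewrite leNgt; exact/negP.
    have : r <= 2 * N%:R * r.
      by rewrite ler_peMl ?(ltW r0)// -natrM ler1n muln_gt0.
    have := ler_norm M; lra.
  by rewrite /= -ball_normE /= distrC.
Qed.

End tails.

(** * Comparison of the two masses at infinity *)

Lemma mass_at_infinity_q_le (R : realType) (N : nat) (s : R)
    (p : 'rV[R]_N -> 'rV[R]_N -> R) (q : 'rV[R]_N -> R)
    (u_ : nat -> 'rV[R]_N -> R) (mu : {charge set 'rV[R]_N -> \bar R})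
    (qoo m lam kap y : R) :
  0 < s < 1 -> condP2 s p -> condQ2 s p q -> (forall n, inW s p (u_ n)) ->
  weak_star_cvg (fun n => energy_density s p (u_ n)) mu ->
  mass_at_infinity (fun n => energy_density s p (u_ n)) = m%:E ->
  p z.1 z.2 @[z --> (@einfty R N, @einfty R N)] --> pbar p ->
  q x @[x --> @einfty R N] --> qoo ->
  0 < S_q s p q -> 0 < lam -> 0 < kap ->
  m < lam `^ pbar p -> lam < kap * S_q s p q -> kap `^ qoo < y ->
  (mass_at_infinity (fun n => q_density q (u_ n)) <= y%:E)%E.
Proof.
move=> hs hP hQ uW hmu mE hp hq S0 lam0 kap0 mlam lamkap kapy.
have N0 := condP2_dim_gt0 hP.
have [uq qb _] := hQ.
have q0 x : 0 < q x.
  have /andP[+ _] := qb x; apply: lt_le_trans.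
  apply: (@lt_le_trans _ _ (pinf p)).
    by have [_ _ [_ _ + _] _ _] := hP; exact: lt_trans.
  apply: lb_le_inf; first by exists (p x 0), 0.
  by move=> _ [z _ <-]; exact: (condP2_pinf_le hP).
have mu_ n : measurable_fun [set: 'rV[R]_N] (u_ n) by have [] := uW n.
have me n := measurable_energy_density hP (mu_ n).
have e0 n x : (0 <= energy_density s p (u_ n) x)%E by exact: energy_density_ge0.
have m0 : 0 <= m.
  by have := mass_at_infinity_ge0 e0 me; rewrite mE lee_fin.
(* The tails of the energy are eventually below [m1] at a fixed radius, though perhaps not below
   [m]. *)
have [m1 /andP[mm1 m1lam]] : exists m1, m < m1 < lam `^ pbar p.
  by exists ((m + lam `^ pbar p) / 2); rewrite !midf_lt.
have total := limn_esup_integral_mass N0 e0 hmu.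
have muT : mu setT \is a fin_num by exact: fin_num_measure.
(* The upper limit of the total energies is [mu setT + m] by the first part, so almost all of them
   are below [B]. *)
pose B := `|fine (mu setT) + m| + 1.
have B0 : 0 <= B by rewrite addr_ge0.
have evB : \forall n \near \oo, (\int[lebesgue_rV R N]_x energy_density s p (u_ n) x < B%:E)%E.
  apply: limn_esup_lt; rewrite total mE -(fineK muT) -EFinD lte_fin.
  by rewrite (le_lt_trans (ler_norm _))// ltrDl.
have [r0 r01 Hr0] := truncation_norm_le hs hP hp lam0 (le_lt_trans m0 mm1) m1lam B0.
have [r1 Hr1] := q_tail_le hs hP uq q0 hq S0 kap0 lamkap kapy.
have [r2 Hr2] : exists r2, (limn_esup (fun n => \int[lebesgue_rV R N]_(x in ~` @eball R N r2)
    energy_density s p (u_ n) x) < m1%:E)%E.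
  by apply: mass_at_infinity_lt => //; rewrite mE lte_fin.
pose r := Num.max r0 (Num.max r1 r2).
have r0r : r0 <= r by rewrite le_max lexx.
have r1r : r1 <= r by rewrite !le_max lexx !orbT.
have r2r : r2 <= r by rewrite !le_max lexx !orbT.
have mq n : measurable_fun [set: 'rV[R]_N] (q_density q (u_ n)).
  apply/measurable_EFinP; apply: measurable_fun_powR2.
    exact: measurableT_comp.
  by apply: continuous_measurable_rV; exact: unif_continuous_continuous.
have q_ge0 n x : (0 <= q_density q (u_ n) x)%E by rewrite lee_fin powR_ge0.
apply: (le_trans (mass_at_infinity_le q_ge0 mq (2 * N%:R * r))).
apply: limn_esup_le; near=> n.
apply: Hr1 => //; first exact: le_trans r0r.
apply: Hr0 => //.
  apply: (@le_trans _ _ (\int[lebesgue_rV R N]_(x in ~` @eball R N r2)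
      energy_density s p (u_ n) x)%E).
    apply: ge0_subset_integral => //.
    - by apply: measurableC; exact: measurable_eball.
    - by apply: measurableC; exact: measurable_eball.
    - exact: measurable_funTS.
    - exact/subsetC/subset_eball.
  by apply: ltW; near: n; exact: limn_esup_lt.
apply: (@le_trans _ _ (\int[lebesgue_rV R N]_x energy_density s p (u_ n) x)%E).
  rewrite -(W_modularE hP (mu_ n)) /W_modular leeDl// integral_ge0// => x _.
  exact: gagliardo_ge0.
by apply: ltW; near: n.
Unshelve. all: by end_near. Qed.

Theorem theorem4p2 (R : realType) (N : nat) (s : R)
    (p : 'rV[R]_N -> 'rV[R]_N -> R) (q : 'rV[R]_N -> R)
    (u_ : nat -> 'rV[R]_N -> R) (u : 'rV[R]_N -> R)
    (mu nu : {charge set 'rV[R]_N -> \bar R})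
    (hs : 0 < s < 1)
    (hP2 : condP2 s p)
    (hQ2 : condQ2 s p q)
    (hbd : W_bounded s p u_)
    (hweak : W_weak_cvg s p u_ u)
    (hmu : weak_star_cvg (fun n => energy_density s p (u_ n)) mu)
    (hnu : weak_star_cvg (fun n => q_density q (u_ n)) nu) :
  let mu_infty := mass_at_infinity (fun n => energy_density s p (u_ n)) in
  let nu_infty := mass_at_infinity (fun n => q_density q (u_ n)) in
  [/\ limn_esup (fun n => \int[lebesgue_rV R N]_x q_density q (u_ n) x)%E =
        (nu setT + nu_infty)%E,
      limn_esup
          (fun n => \int[lebesgue_rV R N]_x energy_density s p (u_ n) x)%E =
        (mu setT + mu_infty)%E &
      forall q_infty : R,
        p z.1 z.2 @[z --> (@einfty R N, @einfty R N)] --> pbar p ->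
        1 < q_infty ->
        q x @[x --> @einfty R N] --> q_infty ->
        ((S_q s p q)%:E * nu_infty `^ q_infty^-1 <=
           mu_infty `^ (pbar p)^-1)%E].
Proof.
have N0 := condP2_dim_gt0 hP2.
have [uW _] := hbd.
have mu_ n : measurable_fun [set: 'rV[R]_N] (u_ n) by have [] := uW n.
have e0 n x : (0 <= energy_density s p (u_ n) x)%E by exact: energy_density_ge0.
have q0 n x : (0 <= q_density q (u_ n) x)%E by rewrite lee_fin powR_ge0.
have me n := measurable_energy_density hP2 (mu_ n).
have mq n : measurable_fun [set: 'rV[R]_N] (q_density q (u_ n)).
  by have [+ _] := hnu; move=> /(_ n)/measurable_int.
move=> mu_infty nu_infty; split.
- exact: limn_esup_integral_mass.
- exact: limn_esup_integral_mass.
move=> qoo hp qoo1 hq.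
have mu0 : (0 <= mu_infty)%E by exact: mass_at_infinity_ge0.
have nu0 : (0 <= nu_infty)%E by exact: mass_at_infinity_ge0.
have muI : mass_at_infinity (fun n => energy_density s p (u_ n)) = mu_infty by exact: erefl.
have nuI : mass_at_infinity (fun n => q_density q (u_ n)) = nu_infty by exact: erefl.
clearbody mu_infty nu_infty.
have P0 : 0 < pbar p by rewrite (lt_trans ltr01)// (pbar_gt1 hP2).
have qoo0 : 0 < qoo by exact: lt_trans qoo1.
(* A nonpositive constant makes the left-hand side nonpositive. *)
have [S0|S0] := leP (S_q s p q) 0.
  apply: (@le_trans _ _ 0%E); last exact: poweR_ge0.
  by rewrite mule_le0_ge0// ?lee_fin// poweR_ge0.
have [muoo|mufin] := eqVneq mu_infty +oo%E.
  by rewrite muoo poweRyr ?leey// gt_eqF// invr_gt0.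
have muE : mu_infty = (fine mu_infty)%:E.
  by rewrite fineK// ge0_fin_numE// lt_neqAle mufin leey.
set m := fine mu_infty in muE.
have m0 : 0 <= m by rewrite fine_ge0.
have key lam kap y : 0 < lam -> 0 < kap -> m < lam `^ pbar p ->
    lam < kap * S_q s p q -> kap `^ qoo < y -> (nu_infty <= y%:E)%E.
  rewrite -nuI => lam0 kap0 mlam lamkap kapy; have mE := etrans muI muE.
  exact: (mass_at_infinity_q_le hs hP2 hQ2 uW hmu mE hp hq S0 lam0 kap0 mlam lamkap).
pose mP := m `^ (pbar p)^-1.
have mP0 : 0 <= mP by exact: powR_ge0.
have lamP lam : mP < lam -> m < lam `^ pbar p.
  move=> h; have -> : m = mP `^ pbar p.
    by rewrite /mP -powRrM mulVf ?gt_eqF// powRr1.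
  by apply: gt0_ltr_powR => //; rewrite nnegrE// ltW// (le_lt_trans mP0).
(* Any admissible choice in [key] gives a finite bound; the choice here merely leaves room of [1] at
   each stage. *)
have nuE : nu_infty = (fine nu_infty)%:E.
  rewrite fineK// ge0_fin_numE//.
  pose lam := mP + 1; pose kap := (lam + 1) / S_q s p q.
  have lam0 : 0 < lam by rewrite ltr_wpDl.
  have : (nu_infty <= (kap `^ qoo + 1)%:E)%E.
    apply: (key lam kap) => //; last by rewrite ltrDl.
    - by rewrite divr_gt0// addr_gt0.
    - by apply: lamP; rewrite ltrDl.
    - by rewrite /kap divfK ?gt_eqF// ltrDl.
  by move=> /le_lt_trans; apply; rewrite ltry.
set v := fine nu_infty in nuE.
have v0 : 0 <= v by rewrite fine_ge0.
rewrite muE nuE !poweR_EFin -EFinM lee_fin -/mP.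
(* If the inequality failed, [lam], then [kap], then [y] could be inserted as midpoints in the
   strict gaps, and [key] would bound [v] by a number below it. *)
rewrite leNgt; apply/negP => h.
pose lam := (mP + S_q s p q * v `^ qoo^-1) / 2.
have /andP[lam1 lam2] : mP < lam < S_q s p q * v `^ qoo^-1 by rewrite !midf_lt.
have lam0 : 0 < lam by exact: le_lt_trans lam1.
have lamv : lam / S_q s p q < v `^ qoo^-1 by rewrite ltr_pdivrMr// mulrC.
pose kap := (lam / S_q s p q + v `^ qoo^-1) / 2.
have /andP[kap1 kap2] : lam / S_q s p q < kap < v `^ qoo^-1 by rewrite !midf_lt.
have kap0 : 0 < kap by rewrite (le_lt_trans _ kap1)// divr_ge0 ?ltW.
have kapv : kap `^ qoo < v.
  have vE : (v `^ qoo^-1) `^ qoo = v by rewrite -powRrM mulVf ?gt_eqF// powRr1.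
  rewrite -[ltRHS]vE; by apply: gt0_ltr_powR => //; rewrite nnegrE ?powR_ge0// ltW.
have /andP[y1 y2] : kap `^ qoo < (kap `^ qoo + v) / 2 < v by rewrite !midf_lt.
have := key _ _ _ lam0 kap0 (lamP _ lam1) _ y1.
rewrite -ltr_pdivrMr// kap1 => /(_ isT).
by rewrite nuE lee_fin leNgt y2.
Qed.
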